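(* Let $(X_k)_{k\in\mathbb{Z}}$ be a strictly stationary sequence of square-integrable real random variables, standardized so that $E(X_k)=0$ and $E(X_k^2)=1$. Put $r_k=E(X_0X_k)$ and $r=r_1$, and assume $r\neq 0$ and $2|r|<1+r_2$. Suppose that there are a symmetric linear polynomial $L(x,y)=a(x+y)+b$ and a symmetric quadratic polynomial $Q(x,y)=A(x^2+y^2)+Bxy+C+D(x+y)$ with real coefficients such that, for all $k\in\mathbb{Z}$, almost surely $$E(X_k\mid \dots,X_{k-2},X_{k-1},X_{k+1},X_{k+2},\dots)=L(X_{k-1},X_{k+1}),$$ $$E(X_k^2\mid \dots,X_{k-2},X_{k-1},X_{k+1},X_{k+2},\dots)=Q(X_{k-1},X_{k+1}).$$ Suppose moreover that $D=0$, that $$A\left(r^2+\frac{1}{r^2}\right)+B=1,$$ and that $$\frac{r^2}{(1+r^2)^2}\leq A\leq \frac{r^2}{1+r^4}.$$ Then $(X_k)$ is a Markov chain, and its distribution is uniquely determined: any two sequences satisfying all of these hypotheses with the same values of $r$ and $A$ have the same finite-dimensional distributions.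
   Context: $E(\,\cdot\mid \dots,X_{k-2},X_{k-1},X_{k+1},X_{k+2},\dots)$ denotes the conditional expectation with respect to the sigma-field generated by $\{X_j: j\neq k\}$. Equalities of conditional expectations are understood almost surely. *)

(* Defs.v *)
From HB Require Import structures.
From mathcomp Require Import all_boot all_order all_algebra.
From mathcomp Require Import all_classical all_reals all_analysis.

Set Implicit Arguments.
Unset Strict Implicit.
Unset Printing Implicit Defensive.

Import Order.TTheory GRing.Theory Num.Theory.
Import numFieldNormedType.Exports.

Local Open Scope classical_set_scope.
Local Open Scope ring_scope.

Section Processes.
Context d (T : measurableType d) (R : realType) (P : probability T R).

Section ConditionalExpectation.
Variable F : set (set T).

Definition measurable_wrt (Y : T -> R) : Prop :=
  forall B : set R, measurable B -> F (Y @^-1` B).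

Definition cond_exp_version (X Y : T -> R) : Prop :=
  [/\ X \in Lfun P 1, Y \in Lfun P 1, measurable_wrt Y &
      forall A : set T, F A ->
        (\int[P]_(w in A) (Y w)%:E = \int[P]_(w in A) (X w)%:E)%E].

(* E(X | F) = Z almost surely. *)
Definition cond_exp_ae (X Z : T -> R) : Prop :=
  exists2 Y : T -> R, cond_exp_version X Y & {ae P, forall w, Y w = Z w}.

End ConditionalExpectation.

Variable X : int -> {RV P >-> R}.

Definition sigma_of (J : set int) : set (set T) :=
  <<s \bigcup_(j in J) preimage_set_system setT (X j) measurable >>.

(* The law of (X_{k_0}, ..., X_{k_{n-1}}), as a set function on R^n. *)
Definition fdd (n : nat) (k : 'I_n -> int) (B : set (n.-tuple R)) : \bar R :=
  P [set w | B [tuple X (k i) w | i < n]].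

Definition strictly_stationary : Prop :=
  forall (n : nat) (k : 'I_n -> int) (h : int) (B : set (n.-tuple R)),
    measurable B -> fdd (fun i => k i + h) B = fdd k B.

Definition autocorr (k : int) : R :=
  fine ('E_P[fun w => (X 0 w * X k w)%R])%E.

(* P(X_{k+1} in B | X_j, j <= k) = P(X_{k+1} in B | X_k) almost surely. *)
Definition markov_chain : Prop :=
  forall (k : int) (B : set R), measurable B ->
    exists2 Y : T -> R,
      cond_exp_version (sigma_of [set k]) \1_(X (k + 1) @^-1` B) Y &
      cond_exp_ae (sigma_of [set j | j <= k]) \1_(X (k + 1) @^-1` B) Y.

Definition sym_linear (a b x y : R) : R := a * (x + y) + b.

Definition sym_quadratic (A B C D x y : R) : R :=
  A * (x ^+ 2 + y ^+ 2) + B * (x * y) + C + D * (x + y).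

Record quadratic_regression_field (a b A B C D : R) : Prop := {
  qrf_stationary : strictly_stationary;
  qrf_square_integrable : forall k, (X k : T -> R) \in Lfun P 2%:E;
  qrf_mean : forall k, ('E_P[X k])%E = 0%E;
  qrf_second_moment : forall k, ('E_P[fun w => ((X k w) ^+ 2)%R])%E = 1%E;
  qrf_r_neq0 : autocorr 1 != 0;
  qrf_r_bound : 2 * `|autocorr 1| < 1 + autocorr 2;
  qrf_linear : forall k,
    cond_exp_ae (sigma_of [set j | j != k]) (X k)
      (fun w => sym_linear a b (X (k - 1) w) (X (k + 1) w));
  qrf_quadratic : forall k,
    cond_exp_ae (sigma_of [set j | j != k]) (fun w => (X k w) ^+ 2)
      (fun w => sym_quadratic A B C D (X (k - 1) w) (X (k + 1) w));
  qrf_D : D = 0;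
  qrf_AB : A * (autocorr 1 ^+ 2 + 1 / autocorr 1 ^+ 2) + B = 1;
  qrf_A_lower : autocorr 1 ^+ 2 / (1 + autocorr 1 ^+ 2) ^+ 2 <= A;
  qrf_A_upper : A <= autocorr 1 ^+ 2 / (1 + autocorr 1 ^+ 4)
}.

End Processes.

Definition same_fdd (R : realType)
    d (T : measurableType d) (P : probability T R) (X : int -> {RV P >-> R})
    d' (T' : measurableType d') (P' : probability T' R)
    (X' : int -> {RV P' >-> R}) : Prop :=
  forall (n : nat) (k : 'I_n -> int) (B : set (n.-tuple R)),
    measurable B -> fdd X k B = fdd X' k B.

(* Main.v *)
Require Import Defs.
From HB Require Import structures.
From mathcomp Require Import all_boot all_order all_algebra.
From mathcomp Require Import all_classical all_reals all_analysis measurable_realfun.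
From mathcomp Require Import ring lra zify.

(** The field is governed by its polynomial moments.

    Two-sided regressions imply one-sided ones. For a fixed bounded function Z
    of the past of X_k, the numbers E[Z X_{k+j}] solve the recurrence
    m_{j+1} = a (m_j + m_{j+2}), whose only bounded solutions are multiples of
    r ^ j; hence E(X_{k+1} | past) = r X_k ([linear_past]). Computing
    E[Z X_{k+1} X_{k+2}] by conditioning in two ways, and using the quadratic
    regression, then gives E(X_{k+1}^2 | past) = r^2 X_k^2 + 1 - r^2
    ([quadratic_past]); the same holds backwards in time. Linear regressions in
    both directions with bounded conditional variances make all moments of X_k
    finite ([regressions_all_moments]).

    Let H_n be the q-Hermite polynomials, with q the function [qparam] of r and
    A; the bounds on A say that |q| <= 1. Conditioning E[Z X_{k+1} H_n(X_{k+2})]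
    and E[Z X_{k+1}^2 H_{n-1}(X_{k+2})] in two ways yields two linear equations
    for E[Z H_{n+1}(X_{k+1})] and E[Z H_{n+1}(X_{k+2})], whose solution is
    E(H_n(X_{k+1}) | past) = r^n H_n(X_k) ([qhermite_contracts]). So the
    polynomials in the next variable see the past through the present one
    only, E H_n(X_k) vanishes for n > 0, and every mixed moment is a function of
    r and A ([mixed_moments]).

    Moments determine laws here. Since |q| <= 1 the moments of X_k grow no
    faster than those of a Gaussian variable, so exp (s |X_k|) has all moments
    ([exp_moments_X]). If two weighted variables have the same weighted
    polynomial means, the power series of the sine shows that multiplying the
    weights by sin (t (X - a)) preserves this coincidence; products, linear
    combinations and bounded limits lead from there to indicators of half-lines
    and of all Borel sets ([preserving_indic]). Weights turn this
    one-dimensional fact into the two assertions of the theorem: replacing the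
    polynomial factors of a mixed moment by indicators one after the other gives
    the finite-dimensional laws ([field_same_fdd]), and taking for weights an
    event of the past and its conditional probability given X_k gives the Markov
    property ([field_markov]).

    Conditional expectations are always used in tested form, as identities
    between means E[Z ...] with Z measurable for the conditioning variables. *)

Set Implicit Arguments.
Unset Strict Implicit.
Unset Printing Implicit Defensive.

Import Order.TTheory GRing.Theory Num.Theory.
Import numFieldNormedType.Exports.

Local Open Scope classical_set_scope.
Local Open Scope ring_scope.

(** * Real-valued means and variables with all moments *)

Section Mean.
Context d (T : measurableType d) (R : realType) (P : probability T R).
Implicit Types (f g : T -> R) (A : set T).

Definition integ f : Prop := P.-integrable setT (EFin \o f).

Definition mean f : R := \int[P]_w f w.

Lemma integ_meas f : integ f -> measurable_fun setT f.
Proof. by move=> /measurable_int/measurable_EFinP. Qed.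

Lemma eq_mean f g : f =1 g -> mean f = mean g.
Proof. by move=> /funext ->. Qed.

Lemma eq_integ f g : f =1 g -> integ f -> integ g.
Proof. by move=> /funext ->. Qed.

Lemma integ_le f g : measurable_fun setT f -> integ g ->
  (forall w, `|f w| <= g w) -> integ f.
Proof.
move=> mf ig fg; apply: le_integrable ig => //; first exact/measurable_EFinP.
move=> w _ /=; rewrite lee_fin; apply: le_trans (fg w) _; exact: ler_norm.
Qed.

Lemma integ_cst c : integ (fun=> c).
Proof. exact: finite_measure_integrable_cst. Qed.

Lemma integD f g : integ f -> integ g -> integ (fun w => f w + g w).
Proof. by move=> intf intg; exact: (integrableD measurableT intf intg). Qed.

Lemma integZ c f : integ f -> integ (fun w => c * f w).
Proof. by move=> intf; exact: (integrableZl measurableT c intf). Qed.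

Lemma integB f g : integ f -> integ g -> integ (fun w => f w - g w).
Proof. by move=> intf intg; exact: (integrableB measurableT intf intg). Qed.

Lemma integ_abs f : integ f -> integ (fun w => `|f w|).
Proof. by move=> intf; exact: integrable_norm. Qed.

Lemma integ_bounded c f : measurable_fun setT f -> (forall w, `|f w| <= c) ->
  integ f.
Proof. by move=> mf fc; apply: integ_le (integ_cst c) fc. Qed.

Lemma norm_indic_le1 A w : `|\1_A w : R| <= 1.
Proof. by rewrite indicE normr_nat; case: (w \in A). Qed.

Lemma integ_indic A : measurable A -> integ \1_A.
Proof.
move=> mA; apply: (@integ_bounded 1) => // w; exact: norm_indic_le1.
Qed.

Lemma integ_mul_bounded c f g : measurable_fun setT f ->
  (forall w, `|f w| <= c) -> integ g -> integ (fun w => f w * g w).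
Proof.
move=> mf fc ig; apply: (@integ_le _ (fun w => c * `|g w|)).
- by apply: measurable_funM => //; exact: integ_meas.
- by apply: integZ; exact: integ_abs.
- by move=> w; rewrite normrM; apply: ler_wpM2r.
Qed.

Lemma integ_indicM A f : measurable A -> integ f ->
  integ (fun w => \1_A w * f w).
Proof.
move=> mA; apply: (@integ_mul_bounded 1); first exact: measurable_indic.
by move=> w; exact: norm_indic_le1.
Qed.

Lemma integM f g : measurable_fun setT f -> measurable_fun setT g ->
  integ (fun w => f w ^+ 2) -> integ (fun w => g w ^+ 2) ->
  integ (fun w => f w * g w).
Proof.
move=> mf mg f2 g2; apply: integ_le (integD f2 g2) _.
  exact: measurable_funM.
move=> w; have := sqr_ge0 (`|f w| - `|g w|).
have := sqr_ge0 (`|f w| + `|g w|).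
rewrite normrM -(real_normK (num_real (f w))) -(real_normK (num_real (g w))).
by move=> *; nra.
Qed.

Lemma meanD f g : integ f -> integ g ->
  mean (fun w => f w + g w) = mean f + mean g.
Proof. by move=> intf intg; exact: RintegralD. Qed.

Lemma meanB f g : integ f -> integ g ->
  mean (fun w => f w - g w) = mean f - mean g.
Proof. by move=> intf intg; exact: RintegralB. Qed.

Lemma meanZ c f : integ f -> mean (fun w => c * f w) = c * mean f.
Proof. by move=> intf; exact: RintegralZl. Qed.

Lemma integ_sum I (s : seq I) (u : I -> T -> R) : (forall i, integ (u i)) ->
  integ (fun w => \sum_(i <- s) u i w).
Proof.
move=> iu; elim: s => [|i s ihs].
  by apply: eq_integ (integ_cst 0) => w; rewrite big_nil.
by apply: eq_integ (integD (iu i) ihs) => w; rewrite big_cons.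
Qed.

Lemma mean_cst c : mean (fun=> c) = c.
Proof. by rewrite /mean Rintegral_cst// [X in fine X](_ : _ = 1%E) ?mulr1//;
  exact: probability_setT. Qed.

Lemma mean_sum I (s : seq I) (u : I -> T -> R) : (forall i, integ (u i)) ->
  mean (fun w => \sum_(i <- s) u i w) = \sum_(i <- s) mean (u i).
Proof.
move=> iu; elim: s => [|i s ihs].
  by rewrite big_nil -[RHS](mean_cst 0); apply: eq_mean => w; rewrite big_nil.
rewrite big_cons -ihs -meanD//; last exact: integ_sum.
by apply: eq_mean => w; rewrite big_cons.
Qed.

Lemma le_mean f g : integ f -> integ g -> (forall w, f w <= g w) ->
  mean f <= mean g.
Proof. by move=> intf intg fg; apply: le_Rintegral. Qed.

Lemma mean_abs f : integ f -> `|mean f| <= mean (fun w => `|f w|).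
Proof. by move=> intf; apply: le_normr_Rintegral. Qed.

Lemma mean_EFin f : integ f -> (mean f)%:E = (\int[P]_w (f w)%:E)%E.
Proof. by move=> intf; rewrite fineK//; exact: integrable_fin_num. Qed.

Lemma mean_indic A : measurable A -> (mean \1_A)%:E = P A.
Proof.
by move=> mA; rewrite mean_EFin ?integral_indic ?setIT//; exact: integ_indic.
Qed.

Lemma mean_restrict A f : measurable A -> 
  mean (fun w => \1_A w * f w) = fine (\int[P]_(w in A) (f w)%:E).
Proof.
move=> mA; rewrite integral_mkcond /mean /Rintegral; congr fine.
apply: eq_integral => w _ /=; rewrite patchE indicE.
by case: ifP; rewrite ?mul1r ?mul0r.
Qed.

Lemma mean_dominated (u : nat -> T -> R) f g :
  (forall n, measurable_fun setT (u n)) -> measurable_fun setT f -> integ g ->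
  (forall n w, `|u n w| <= g w) ->
  (forall w, (fun n => u n w) @ \oo --> f w) ->
  (fun n => mean (u n)) @ \oo --> mean f.
Proof.
move=> mu mf ig ug uf.
have [] // := @dominated_convergence _ _ _ P setT measurableT
   (fun n => EFin \o u n) (EFin \o f) (EFin \o g).
- by move=> n; exact/measurable_EFinP.
- exact/measurable_EFinP.
- apply: aeW => w _ /=; apply: cvg_EFin; first by near=> n.
  exact: uf.
- by apply: aeW => w n _ /=; rewrite lee_fin.
move=> intf _ ulim; apply: fine_cvg.
rewrite (_ : (_ : R)%:E = (\int[P]_w (f w)%:E)%E); last exact: mean_EFin.
exact: ulim.
Unshelve. all: by end_near. Qed.

(** Fatou's lemma, as used to pass from truncations to the untruncated
    variable. *)
Lemma integ_fatou (u : nat -> T -> R) f (K : R) :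
  (forall n, integ (u n)) -> (forall n w, 0 <= u n w) ->
  (forall n, mean (u n) <= K) -> measurable_fun setT f ->
  (forall w, (fun n => u n w) @ \oo --> f w) -> integ f.
Proof.
move=> iu u0 uK mf uf.
have f0 w : 0 <= f w.
  rewrite -(cvg_lim (@Rhausdorff R) (uf w)); apply: limr_ge.
    by apply/cvg_ex; exists (f w); exact: uf.
  by near=> n; exact: u0.
apply/integrableP; split; first exact/measurable_EFinP.
have -> : (\int[P]_w `|(EFin \o f) w| =
           \int[P]_w limn_einf (fun n => (u n w)%:E))%E.
  apply: eq_integral => w _ /=; rewrite ger0_norm//.
  have /is_cvg_limn_einfE -> : cvgn (fun n => (u n w)%:E).
    by apply/cvg_ex; exists (f w)%:E; apply: cvg_EFin; [near=> n|exact: uf].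
  apply/esym/cvg_lim => //; apply: cvg_EFin; [by near=> n|exact: uf].
apply: le_lt_trans (fatou P measurableT _ _) _.
- by move=> n; apply/measurable_EFinP; exact: integ_meas.
- by move=> n w _; rewrite lee_fin.
apply: (@le_lt_trans _ _ K%:E); last by rewrite ltry.
rewrite limn_einf_lim; apply: lime_le; first exact: is_cvg_einfs.
near=> n; apply: (@le_trans _ _ (mean (u n))%:E); last by rewrite lee_fin.
by rewrite mean_EFin//; apply: ereal_inf_lbound; exists n => /=.
Unshelve. all: by end_near. Qed.

(** These variables form an algebra, which makes the products met below
    integrable. *)
Definition all_moments f : Prop :=
  measurable_fun setT f /\ forall n, integ (fun w => `|f w| ^+ n).

Lemma am_meas f : all_moments f -> measurable_fun setT f.
Proof. by case. Qed.

Lemma am_integ f : all_moments f -> integ f.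
Proof.
by case=> mf /(_ 1%N) f1; apply: integ_le f1 _ => // w; rewrite expr1.
Qed.

Lemma am_le f g : measurable_fun setT f -> (forall w, `|f w| <= `|g w|) ->
  all_moments g -> all_moments f.
Proof.
move=> mf fg [mg ig]; split=> // n; apply: integ_le (ig n) _.
  by apply: measurable_funX; exact: measurableT_comp.
by move=> w; rewrite normrX normr_id lerXn2r ?nnegrE.
Qed.

Lemma am_cst c : all_moments (fun=> c).
Proof. by split=> // n; exact: integ_cst. Qed.

Lemma am_bounded c f : measurable_fun setT f -> (forall w, `|f w| <= c) ->
  all_moments f.
Proof.
move=> mf fc; apply: am_le (am_cst c) => // w.
by apply: le_trans (fc w) _; exact: ler_norm.
Qed.

(** By |x|^n <= 1 + x^(2n). *)
Lemma am_even f : measurable_fun setT f ->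
  (forall n, integ (fun w => f w ^+ n.*2)) -> all_moments f.
Proof.
move=> mf f2; split=> // n.
apply: integ_le (integD (integ_cst 1) (f2 n)) _.
  by apply: measurable_funX; exact: measurableT_comp.
move=> w; rewrite normrX normr_id -mul2n exprM -(real_normK (num_real (f w))).
rewrite -exprM mulnC exprM; have : 0 <= `|f w| ^+ n by exact: exprn_ge0.
by move: (_ ^+ n) => x x0; nra.
Qed.

Lemma amM f g : all_moments f -> all_moments g ->
  all_moments (fun w => f w * g w).
Proof.
move=> [mf f2] [mg g2]; split; first exact: measurable_funM.
move=> n; have := integD (f2 (n * 2)%N) (g2 (n * 2)%N).
move/integ_le; apply.
  by apply: measurable_funX; apply: measurableT_comp => //; exact: measurable_funM.
move=> w; rewrite normrX normr_id normrM exprMn !exprM.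
have := sqr_ge0 (`|f w| ^+ n - `|g w| ^+ n).
have : 0 <= `|f w| ^+ n by exact: exprn_ge0.
have : 0 <= `|g w| ^+ n by exact: exprn_ge0.
by move: (_ ^+ n) (_ ^+ n) => x y *; nra.
Qed.

Lemma amD f g : all_moments f -> all_moments g ->
  all_moments (fun w => f w + g w).
Proof.
move=> [mf f2] [mg g2]; split; first exact: measurable_funD.
move=> n; have := integZ (2 ^+ n) (integD (f2 n) (g2 n)).
move/integ_le; apply.
  by apply: measurable_funX; apply: measurableT_comp => //; exact: measurable_funD.
move=> w; rewrite normrX normr_id.
have h x y : 0 <= x -> x <= y -> (x + y : R) ^+ n <= 2 ^+ n * (x ^+ n + y ^+ n).
  move=> x0 xy; have y0 : 0 <= y by exact: le_trans xy.
  apply: (@le_trans _ _ ((2 * y) ^+ n)).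
    by rewrite lerXn2r ?nnegrE ?addr_ge0 ?mulr_ge0//; lra.
  by rewrite exprMn ler_wpM2l ?exprn_ge0// lerDr exprn_ge0.
apply: (@le_trans _ _ ((`|f w| + `|g w|) ^+ n)).
  by rewrite lerXn2r ?nnegrE ?addr_ge0// ler_normD.
case: (leP `|f w| `|g w|) => fg; first exact: h.
by rewrite addrC [X in _ * X]addrC; apply: h => //; exact: ltW.
Qed.

Lemma amZ c f : all_moments f -> all_moments (fun w => c * f w).
Proof. by move=> af; apply: amM => //; exact: am_cst. Qed.

Lemma amX f n : all_moments f -> all_moments (fun w => f w ^+ n).
Proof.
move=> [mf f2]; split; first exact: measurable_funX.
by move=> m; apply: eq_integ (f2 (n * m)%N) => w; rewrite normrX exprM.
Qed.

Lemma am_indic A : measurable A -> all_moments \1_A.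
Proof.
move=> mA; apply: (@am_bounded 1) => // w; exact: norm_indic_le1.
Qed.

Lemma am_horner f (p : {poly R}) : all_moments f ->
  all_moments (fun w => p.[f w]).
Proof.
move=> af; elim/poly_ind: p => [|p c ihp].
  by under eq_fun do rewrite horner0; exact: am_cst.
under eq_fun do rewrite hornerMXaddC.
by apply: amD; [exact: amM|exact: am_cst].
Qed.

Lemma am_prod I (s : seq I) (u : I -> T -> R) :
  (forall i, all_moments (u i)) -> all_moments (fun w => \prod_(i <- s) u i w).
Proof.
move=> au; elim: s => [|i s ihs].
  by under eq_fun do rewrite big_nil; exact: am_cst.
by under eq_fun do rewrite big_cons; exact: amM.
Qed.

Section PolynomialTests.
Variables (W X : T -> R) (aW : all_moments W) (aX : all_moments X).

Definition poly_mean (p : {poly R}) : R := mean (fun w => W w * p.[X w]).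

Lemma poly_meanD p q : poly_mean (p + q) = poly_mean p + poly_mean q.
Proof.
rewrite /poly_mean -meanD; last 2 first.
- by apply: am_integ; apply: amM => //; exact: am_horner.
- by apply: am_integ; apply: amM => //; exact: am_horner.
by apply: eq_mean => w; rewrite hornerD mulrDr.
Qed.

Lemma poly_meanZ c p : poly_mean (c *: p) = c * poly_mean p.
Proof.
rewrite /poly_mean -meanZ; last first.
  by apply: am_integ; apply: amM => //; exact: am_horner.
by apply: eq_mean => w; rewrite hornerZ mulrCA.
Qed.

End PolynomialTests.

End Mean.

(** * Testing conditional expectations *)

Section Extension.
Import HBNNSimple.
Context d (T : measurableType d) (R : realType) (P : probability T R).
Implicit Types (G : set (set T)).

Lemma measurable_wrtP G (Y : T -> R) :
  measurable_wrt <<s G>> Y <-> measurable_fun [set: g_sigma_algebraType G] Y.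
Proof.
split=> [mY _ B mB|mY B mB]; first by rewrite setTI; exact: mY.
by rewrite -[_ @^-1` _]setTI; apply: mY.
Qed.

Lemma measurable_wrt_fun G (Y : T -> R) :
  (forall A, <<s G>> A -> measurable A) -> measurable_wrt <<s G>> Y ->
  measurable_fun setT Y.
Proof. by move=> GT mY _ B mB; rewrite setTI; apply: GT; exact: mY. Qed.

(** The approximating functions are simple for the generated sigma-algebra
    itself, so that [U] is orthogonal to the indicators of their level sets. *)
Let orthogonal_ge0 G (U Z : T -> R) :
  (forall A, <<s G>> A -> measurable A) -> integ P U ->
  (forall A, <<s G>> A -> mean P (fun w => \1_A w * U w) = 0) ->
  measurable_wrt <<s G>> Z -> (forall w, 0 <= Z w) ->
  integ P (fun w => Z w * U w) -> mean P (fun w => Z w * U w) = 0.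
Proof.
move=> GT iU U0 mZ Z0 iZU.
have mZS : measurable_fun [set: g_sigma_algebraType G] (EFin \o Z).
  by apply/measurable_EFinP/measurable_wrtP.
pose z := nnsfun_approx measurableT mZS.
have mz n B : measurable B -> <<s G>> (z n @^-1` B).
  move=> mB; exact: (@measurable_funPTI _ _ _ _ (z n) _ mB).
have zZ n w : 0 <= z n w <= Z w.
  rewrite /z nnsfun_approxE -!lee_fin; apply/andP; split.
    by rewrite -(nnsfun_approxE measurableT mZS) lee_fin; apply: fun_ge0.
  by apply: le_approx => // x _; rewrite lee_fin.
have zlim w : (fun n => z n w) @ \oo --> Z w.
  have := @cvg_nnsfun_approx _ _ R setT measurableT _ mZS _ w I.
  by move=> /(_ _)/fine_cvg; apply => x _; rewrite lee_fin.
have zU0 n : mean P (fun w => z n w * U w) = 0.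
  have [s zs] : exists s : seq R, forall w,
      z n w = \sum_(y <- s) (y * \1_(z n @^-1` [set y]) w).
    exists (finmap.enum_fset (fset_set (range (z n)))) => w.
    by rewrite fimfunE fsbig_finite.
  have iA c : integ P (fun w => \1_(z n @^-1` [set c]) w * U w).
    by apply: integ_indicM => //; apply: GT; exact: mz.
  have -> : mean P (fun w => z n w * U w) = mean P (fun w =>
      \sum_(y <- s) (y * (\1_(z n @^-1` [set y]) w * U w))).
    apply: eq_mean => w; rewrite zs mulr_suml.
    by apply: eq_bigr => i _; rewrite mulrA.
  rewrite mean_sum => [|c]; last by apply: integZ; exact: iA.
  rewrite big1// => c _; rewrite meanZ; last exact: iA.
  by rewrite U0 ?mulr0//; exact: mz.
have := @mean_dominated _ _ _ P (fun n w => z n w * U w) (fun w => Z w * U w)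
  (fun w => `|Z w * U w|).
move=> /(_ _ _ _ _ _)/(cvg_lim (@Rhausdorff R)) <-.
- by rewrite (_ : (fun n => _) = cst 0) ?lim_cst//; apply/funext => n.
- move=> n; apply: measurable_funM; last exact: integ_meas iU.
  by apply: (measurable_wrt_fun GT) => B; exact: mz.
- exact: integ_meas iZU.
- exact: integ_abs.
- move=> n w; rewrite !normrM; apply: ler_wpM2r => //.
  have /andP[z0 zle] := zZ n w.
  by rewrite ger0_norm// ger0_norm.
- by move=> w; apply: cvgMl; exact: zlim.
Qed.

(** Orthogonality to the sets of a sigma-algebra passes to every function
    measurable for it, by approximation with simple functions. *)
Lemma orthogonal_measurable G (U Z : T -> R) :
  (forall A, <<s G>> A -> measurable A) -> integ P U ->
  (forall A, <<s G>> A -> mean P (fun w => \1_A w * U w) = 0) ->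
  measurable_wrt <<s G>> Z -> integ P (fun w => Z w * U w) ->
  mean P (fun w => Z w * U w) = 0.
Proof.
move=> GT iU U0 mZ iZU.
have mZT := measurable_wrt_fun GT mZ.
have mU := integ_meas iU.
have ipos : integ P (fun w => (Z^\+)%R w * U w).
  apply: integ_le (integ_abs iZU) _.
    by apply: measurable_funM => //; exact: measurable_funrpos.
  move=> w; rewrite !normrM ler_wpM2r// ger0_norm ?funrpos_ge0//.
  by rewrite /funrpos ge_max ler_norm normr_ge0.
have ineg : integ P (fun w => (Z^\-)%R w * U w).
  apply: integ_le (integ_abs iZU) _.
    by apply: measurable_funM => //; exact: measurable_funrneg.
  move=> w; rewrite !normrM ler_wpM2r// ger0_norm ?funrneg_ge0//.
  by rewrite /funrneg ge_max -normrN ler_norm normr_ge0.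
have -> : mean P (fun w => Z w * U w) =
    mean P (fun w => (Z^\+)%R w * U w - (Z^\-)%R w * U w).
  by apply: eq_mean => w; rewrite -mulrBl -[in LHS](funrposBneg Z).
move/measurable_wrtP in mZ.
rewrite meanB// (orthogonal_ge0 GT iU U0) ?(orthogonal_ge0 GT iU U0) ?subrr//.
- by apply/measurable_wrtP; exact: measurable_funrneg.
- by apply/measurable_wrtP; exact: measurable_funrpos.
Qed.

(** A version of a conditional expectation may be tested against every
    function measurable for the conditioning sigma-algebra, and the test only
    sees the almost sure class of that version. *)
Lemma cond_exp_test G (V L Z : T -> R) :
  (forall A, <<s G>> A -> measurable A) ->
  cond_exp_ae P <<s G>> V L -> integ P L -> measurable_wrt <<s G>> Z ->
  integ P (fun w => Z w * V w) -> integ P (fun w => Z w * L w) ->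
  mean P (fun w => Z w * V w) = mean P (fun w => Z w * L w).
Proof.
move=> GT [Y [/Lfun1_integrable iV /Lfun1_integrable iY mY YV] YL] iL mZ iZV iZL.
apply/eqP; rewrite -subr_eq0 -meanB//; apply/eqP.
under eq_mean do rewrite -mulrBr.
apply: (orthogonal_measurable GT) => //.
- exact: integB.
- move=> A GA; have mA := GT _ GA.
  under eq_mean do rewrite mulrBr.
  rewrite meanB; [|exact: integ_indicM|exact: integ_indicM].
  rewrite !mean_restrict// -(YV _ GA); apply/eqP; rewrite subr_eq0; apply/eqP.
  congr fine; apply: ae_eq_integral => //.
  + by apply: measurable_funTS; exact: measurable_int iY.
  + by apply: measurable_funTS; exact: measurable_int iL.
  + by move: YL; apply: filterS => w /= YL _; rewrite YL.
- by under eq_fun do rewrite mulrBr; exact: integB.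
Qed.

End Extension.

(** * Moment determinacy with weights *)

Section MomentDeterminacy.
Context (R : realType).
Context d (T : measurableType d) (P : probability T R) (X : T -> R).
Context d' (T' : measurableType d') (P' : probability T' R) (X' : T' -> R).

Definition matched (W : T -> R) (W' : T' -> R) : Prop :=
  [/\ all_moments P W, all_moments P' W' &
      forall p, poly_mean P W X p = poly_mean P' W' X' p].

(** The functions by which matched weights may be multiplied. Quantifying over
    all weights is what closes this class under products. *)
Definition preserving (f : R -> R) : Prop :=
  [/\ measurable_fun setT f, exists c, forall x, `|f x| <= c &
      forall W W', matched W W' ->
        matched (fun w => W w * f (X w)) (fun w => W' w * f (X' w))].

End MomentDeterminacy.

Definition exp_moments d (T : measurableType d) (R : realType)
    (P : probability T R) (X : T -> R) : Prop :=
  measurable_fun setT X /\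
  forall s, all_moments P (fun w => expR (s * `|X w|)).

Section ExpMoments.
Context d (T : measurableType d) (R : realType) (P : probability T R).

Lemma exp_moments_am (X : T -> R) : exp_moments P X -> all_moments P X.
Proof.
move=> [mX /(_ 1)]; apply: am_le => // w.
rewrite mul1r [leRHS]ger0_norm ?expR_ge0//.
by apply: (@le_trans _ _ (1 + `|X w|)); [rewrite lerDr|exact: expR_ge1Dx].
Qed.

End ExpMoments.

Lemma measurable_lim d (T : measurableType d) (R : realType)
    (f : nat -> T -> R) (g : T -> R) :
  (forall n, measurable_fun setT (f n)) ->
  (forall x, (fun n => f n x) @ \oo --> g x) -> measurable_fun setT g.
Proof.
move=> mf fg; apply/measurable_EFinP.
apply: (emeasurable_fun_cvg (fun n => EFin \o f n)) => [n|x _].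
  exact/measurable_EFinP.
by apply: cvg_EFin; [near=> n|exact: fg].
Unshelve. all: by end_near. Qed.

Section SignIteration.
Context (R : realType).

(** The odd cubic for which 1 - steepen u has a double zero at 1. *)
Definition steepen (u : R) : R := (3 * u - u ^+ 3) / 2.

Lemma steepen_itv (u : R) : `|u| <= 1 -> `|steepen u| <= 1.
Proof.
rewrite /steepen !ler_norml => /andP[u1 u2]; apply/andP; split.
  suff : 0 <= (1 + u) ^+ 2 * (2 - u) by lra.
  by rewrite mulr_ge0 ?sqr_ge0//; lra.
suff : 0 <= (1 - u) ^+ 2 * (2 + u) by lra.
by rewrite mulr_ge0 ?sqr_ge0//; lra.
Qed.

Let steepen_pos (u : R) k : 0 < u <= 1 ->
  u <= iter k steepen u <= 1 /\ 1 - iter k steepen u <= (1 - u / 2) ^+ k.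
Proof.
move=> /andP[u0 u1]; elim: k => [|k [/andP[ul lu] ihk]] /=.
  by rewrite lexx u1 expr0; split=> //; lra.
move: (iter k steepen u) ul lu ihk => v uv v1 ihk.
have v0 : 0 < v by exact: lt_le_trans uv.
have vv : v <= steepen v <= 1.
  apply/andP; split; last first.
    apply: le_trans (ler_norm _) _; apply: steepen_itv.
    by rewrite ger0_norm// ltW.
  suff : 0 <= v * ((1 - v) * (1 + v)) by rewrite /steepen; lra.
  by rewrite !mulr_ge0//; lra.
split; first by case/andP : vv => vv ->; rewrite (le_trans uv).
rewrite exprSr; apply: (@le_trans _ _ ((1 - v) * (1 - u / 2))).
  suff : 0 <= (1 - v) * (v - u + v ^+ 2) by rewrite /steepen; lra.
  have := sqr_ge0 v; by move=> ?; apply: mulr_ge0; lra.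
by apply: ler_wpM2r => //; lra.
Qed.

Lemma steepenN (u : R) : steepen (- u) = - steepen u.
Proof. by rewrite /steepen; field. Qed.

Lemma iter_steepenN (u : R) k : iter k steepen (- u) = - iter k steepen u.
Proof. by elim: k => //= k ->; rewrite steepenN. Qed.

(** On [-1, 1] the fixed points of [steepen] are -1, 0 and 1, and other points
    move away from 0: 1 - steepen v is at most (1 - v) (1 - u / 2) for
    0 < u <= v <= 1. The iterates are polynomials, so the sign function becomes
    a bounded limit of polynomials. *)
Lemma steepen_cvg (u : R) : `|u| <= 1 ->
  (fun k => iter k steepen u) @ \oo --> Num.sg u.
Proof.
have pos v : 0 < v <= 1 -> (fun k => iter k steepen v) @ \oo --> (1 : R).
  move=> v01; have /andP[v0 v1] := v01.
  apply: (@squeeze_cvgr _ _ _ _ (fun k => 1 - (1 - v / 2) ^+ k) (fun=> 1)).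
  - near=> k; have [/andP[_ ->] h] := steepen_pos k v01.
    by rewrite andbT lerBlDr -lerBlDl.
  - rewrite -[X in _ --> X]subr0; apply: cvgB; first exact: cvg_cst.
    by apply: cvg_expr; rewrite ger0_norm; lra.
  - exact: cvg_cst.
rewrite ler_norml => /andP[uN u1]; case: (sgrP u) => [->|u0|u0].
- rewrite (_ : (fun _ => _) = cst 0); first exact: cvg_cst.
  by apply/funext; elim=> //= k ->; rewrite /steepen; field.
- by apply: pos; rewrite u0.
- rewrite -[u]opprK; under eq_fun do rewrite iter_steepenN.
  by apply: cvgN; apply: pos; rewrite oppr_gt0 u0 lerNl.
Unshelve. all: by end_near. Qed.

Lemma sin_sg (y : R) : `|y| <= 1 -> Num.sg (sin y) = Num.sg y.
Proof.
have pi1 : 1 < pi :> R by apply: lt_le_trans (pi_ge2 R); lra.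
rewrite ler_norml => /andP[yN y1]; case: (sgrP y) => [->|y0|y0].
- by rewrite sin0 sgr0.
- by rewrite gtr0_sg// sin_gt0_pi// y0 (le_lt_trans y1).
- rewrite ltr0_sg// -oppr_gt0 -sinN sin_gt0_pi// oppr_gt0 y0.
  by apply: le_lt_trans pi1; lra.
Qed.

Definition sin_poly (t a : R) (n : nat) : {poly R} :=
  \sum_(0 <= i < n) ((odd i)%:R * (-1) ^+ i.-1./2 / i`!%:R) *:
    (t *: ('X - a%:P)) ^+ i.

Lemma sin_polyE t a n x :
  (sin_poly t a n).[x] = series (sin_coeff (t * (x - a))) n.
Proof.
rewrite /sin_poly horner_sum seriesEnat /=; apply: eq_bigr => i _.
by rewrite hornerZ horner_exp hornerZ hornerXsubC /sin_coeff/= mulrAC.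
Qed.

(** Each Taylor polynomial of the sine is dominated by the exponential series,
    uniformly in the degree. *)
Lemma sin_poly_le t a n x : `|(sin_poly t a n).[x]| <=
  expR (`|t| * `|a|) * expR (`|t| * `|x|).
Proof.
rewrite -expRD -mulrDr; apply: (@le_trans _ _ (expR `|t * (x - a)|)); last first.
  by rewrite ler_expR normrM ler_wpM2l// [leRHS]addrC ler_normB.
rewrite sin_polyE; move: (t * (x - a)) => y.
apply: (@le_trans _ _ (series (exp_coeff `|y|) n)).
  rewrite !seriesEnat /=; apply: le_trans (ler_norm_sum _ _ _) _.
  apply: ler_sum => i _; rewrite /sin_coeff /exp_coeff /=.
  rewrite !normrM normfV !normr_nat !normrX normrN normr1 expr1n mulr1.
  case: odd; last by rewrite !mul0r mulr_ge0.
  by rewrite mul1r.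
apply: nondecreasing_cvgn_le; last exact: is_cvg_series_exp_coeff.
by apply: nondecreasing_series => i _ _; exact: exp_coeff_ge0.
Qed.

Lemma sin_poly_cvg t a x :
  (fun n => (sin_poly t a n).[x]) @ \oo --> sin (t * (x - a)).
Proof.
under eq_fun do rewrite sin_polyE.
by rewrite unlock; exact: is_cvg_series_sin_coeff.
Qed.

End SignIteration.


Section PreservingFunctions.
Context (R : realType).
Context d (T : measurableType d) (P : probability T R) (X : T -> R).
Context d' (T' : measurableType d') (P' : probability T' R) (X' : T' -> R).
Hypotheses (eX : exp_moments P X) (eX' : exp_moments P' X').
Local Notation matched := (matched P X P' X').
Local Notation preserving := (preserving P X P' X').
Implicit Types (f g : R -> R) (B : set R).

Let amX : all_moments P X. Proof. exact: exp_moments_am. Qed.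
Let amX' : all_moments P' X'. Proof. exact: exp_moments_am. Qed.

Lemma eq_preserving f g : f =1 g -> preserving f -> preserving g.
Proof. by move=> /funext ->. Qed.

Let am_mul_bounded d0 (T0 : measurableType d0) (P0 : probability T0 R)
    (W X0 : T0 -> R) f c : all_moments P0 W -> measurable_fun setT X0 ->
  measurable_fun setT f -> (forall x, `|f x| <= c) ->
  all_moments P0 (fun w => W w * f (X0 w)).
Proof.
move=> aW mX0 mf fc; apply: amM => //; apply: (@am_bounded _ _ _ _ c) => //.
exact: measurableT_comp.
Qed.

Lemma preserving_cst c : preserving (fun=> c).
Proof.
split=> // [|W W' [aW aW' WW']]; first by exists `|c|.
split=> [||p]; [exact: amM (am_cst _ _)|exact: amM (am_cst _ _)|].
have := WW' (c *: p); rewrite !poly_meanZ// => h.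
transitivity (c * poly_mean P W X p).
  by rewrite -poly_meanZ//; apply: eq_mean => w; rewrite hornerZ mulrA.
by rewrite h -poly_meanZ//; apply: eq_mean => w; rewrite hornerZ mulrA.
Qed.

Lemma preservingM f g : preserving f -> preserving g ->
  preserving (fun x => f x * g x).
Proof.
move=> [mf [c fc] hf] [mg [e ge] hg]; split; first exact: measurable_funM.
  by exists (c * e) => x; rewrite normrM ler_pM.
move=> W W' /hf/hg; congr matched; apply/funext => w; exact/esym/mulrA.
Qed.

Lemma preservingD f g : preserving f -> preserving g ->
  preserving (fun x => f x + g x).
Proof.
move=> [mf [c fc] hf] [mg [e ge] hg]; split; first exact: measurable_funD.
  by exists (c + e) => x; apply: le_trans (ler_normD _ _) _; exact: lerD.
move=> W W' WW'.
have [af af' ff'] := hf _ _ WW'; have [ag ag' gg'] := hg _ _ WW'.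
have split_mean d0 (T0 : measurableType d0) (P0 : probability T0 R)
    (V X0 : T0 -> R) p : all_moments P0 X0 ->
    all_moments P0 (fun w => V w * f (X0 w)) ->
    all_moments P0 (fun w => V w * g (X0 w)) ->
    all_moments P0 (fun w => V w * (f (X0 w) + g (X0 w))) /\
    poly_mean P0 (fun w => V w * (f (X0 w) + g (X0 w))) X0 p =
    poly_mean P0 (fun w => V w * f (X0 w)) X0 p +
    poly_mean P0 (fun w => V w * g (X0 w)) X0 p.
  move=> aX0 aVf aVg; split.
    by under eq_fun do rewrite mulrDr; exact: amD.
  rewrite /poly_mean -meanD; last 2 first.
  - by apply: am_integ; apply: amM => //; exact: am_horner.
  - by apply: am_integ; apply: amM => //; exact: am_horner.
  by apply: eq_mean => w; rewrite mulrDr mulrDl.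
split=> [||p].
- by have [] := split_mean _ _ _ _ _ 0 amX af ag.
- by have [] := split_mean _ _ _ _ _ 0 amX' af' ag'.
- have [_ ->] := split_mean _ _ _ _ _ p amX af ag.
  have [_ ->] := split_mean _ _ _ _ _ p amX' af' ag'.
  by rewrite ff' gg'.
Qed.

Lemma preservingZ c f : preserving f -> preserving (fun x => c * f x).
Proof. by move=> pf; apply: preservingM => //; exact: preserving_cst. Qed.

Lemma preserving_lim (f : nat -> R -> R) g c :
  (forall n, preserving (f n)) -> (forall n x, `|f n x| <= c) ->
  (forall x, (fun n => f n x) @ \oo --> g x) -> preserving g.
Proof.
move=> pf fc fg.
have mf n : measurable_fun setT (f n) by case: (pf n).
have mg : measurable_fun setT g := measurable_lim mf fg.
have gc x : `|g x| <= c.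
  have h : (fun n => `|f n x|) @ \oo --> `|g x| by apply: cvg_norm; exact: fg.
  rewrite -(cvg_lim (@Rhausdorff R) h); apply: limr_le.
    by apply/cvg_ex; exists `|g x|.
  by near=> n; exact: fc.
have lim_mean d0 (T0 : measurableType d0) (P0 : probability T0 R)
    (W X0 : T0 -> R) p : all_moments P0 W -> all_moments P0 X0 ->
    (fun n => poly_mean P0 (fun w => W w * f n (X0 w)) X0 p) @ \oo -->
    poly_mean P0 (fun w => W w * g (X0 w)) X0 p.
  move=> aW aX0; have ap := am_horner p aX0.
  have mX0 := am_meas aX0.
  apply: (@mean_dominated _ _ _ _ _ _ (fun w => c * `|W w * p.[X0 w]|)).
  - move=> n; apply: measurable_funM; last exact: am_meas ap.
    by apply: measurable_funM; [exact: am_meas aW|exact: measurableT_comp].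
  - apply: measurable_funM; last exact: am_meas ap.
    by apply: measurable_funM; [exact: am_meas aW|exact: measurableT_comp].
  - by apply: integZ; apply: integ_abs; apply: am_integ; exact: amM.
  - by move=> n w; rewrite mulrAC normrM mulrC ler_wpM2r.
  - by move=> w; apply: cvgMl; apply: cvgMr; exact: fg.
split=> // [|W W' WW']; first by exists c.
have [aW aW' _] := WW'.
split=> [||p].
- exact: am_mul_bounded (am_meas amX) mg gc.
- exact: am_mul_bounded (am_meas amX') mg gc.
have := lim_mean _ _ _ _ _ p aW' amX'.
have := lim_mean _ _ _ _ _ p aW amX.
rewrite (_ : (fun n => poly_mean P _ X p) =
    fun n => poly_mean P' (fun w => W' w * f n (X' w)) X' p); last first.
  by apply/funext => n; have [_ _ /(_ _ _ WW')[_ _ ->]] := pf n.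
exact: (@cvg_unique _ (@Rhausdorff R)).
Unshelve. all: by end_near. Qed.

(** A bounded function that is a limit of polynomials dominated by an
    exponential inherits from its approximants the property of having the same
    means on both sides: this is where exponential integrability enters. *)
Lemma preserving_entire (p_ : nat -> {poly R}) g c c' s :
  measurable_fun setT g -> (forall x, `|g x| <= c) ->
  (forall n x, `|(p_ n).[x]| <= c' * expR (s * `|x|)) ->
  (forall x, (fun n => (p_ n).[x]) @ \oo --> g x) -> preserving g.
Proof.
move=> mg gc pexp pg.
have lim_mean d0 (T0 : measurableType d0) (P0 : probability T0 R)
    (W X0 : T0 -> R) p : all_moments P0 W -> exp_moments P0 X0 ->
    (fun n => poly_mean P0 W X0 (p_ n * p)) @ \oo -->
    poly_mean P0 (fun w => W w * g (X0 w)) X0 p.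
  move=> aW eX0; have aX0 := exp_moments_am eX0.
  have ap := am_horner p aX0; have [mX0 aexp] := eX0.
  apply: (@mean_dominated _ _ _ _ _ _
    (fun w => c' * `|W w * p.[X0 w] * expR (s * `|X0 w|)|)).
  - by move=> n; apply: am_meas (amM aW (am_horner _ aX0)).
  - apply: measurable_funM; last exact: am_meas ap.
    by apply: measurable_funM; [exact: am_meas aW|exact: measurableT_comp].
  - apply: integZ; apply: integ_abs; apply: am_integ; apply: amM (aexp s).
    exact: amM.
  - move=> n w; rewrite hornerM mulrCA normrM [`|_ * _ * expR _|]normrM.
    rewrite [X in _ <= c' * (_ * X)]ger0_norm ?expR_ge0// mulrCA mulrC.
    exact: ler_wpM2l.
  - move=> w; under eq_fun do rewrite hornerM mulrA.
    by apply: cvgMl; apply: cvgMr; exact: pg.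
split=> // [|W W' [aW aW' WW']]; first by exists c.
split=> [||p].
- exact: am_mul_bounded (am_meas amX) mg gc.
- exact: am_mul_bounded (am_meas amX') mg gc.
have := lim_mean _ _ _ _ _ p aW' eX'.
have := lim_mean _ _ _ _ _ p aW eX.
rewrite (_ : (fun n => poly_mean P _ X _) = fun n => poly_mean P' W' X' (p_ n * p)).
  exact: (@cvg_unique _ (@Rhausdorff R)).
by apply/funext => n; exact: WW'.
Qed.

Lemma preserving_sin t a : preserving (fun x => sin (t * (x - a))).
Proof.
apply: (preserving_entire _ _ (@sin_poly_le _ t a) (@sin_poly_cvg _ t a)).
  apply: measurableT_comp; last by apply: measurable_funM => //; exact: measurable_funB.
  by apply: continuous_measurable_fun => x; exact: continuous_sin.
by move=> x; exact: sin_max.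
Qed.

Lemma preserving_iter_steepen k f : preserving f ->
  preserving (fun x => iter k (@steepen R) (f x)).
Proof.
move=> pf; elim: k => //= k ihk.
apply: (@eq_preserving (fun x => 3 / 2 * iter k (@steepen R) (f x) +
   - 2^-1 * (iter k (@steepen R) (f x) *
     (iter k (@steepen R) (f x) * iter k (@steepen R) (f x))))).
  by move=> x; rewrite /steepen; field.
by apply: preservingD; apply: preservingZ => //; do ?apply: preservingM.
Qed.

Lemma sg_le1 (x : R) : `|Num.sg x| <= 1.
Proof. by rewrite normr_sg; case: (x != 0). Qed.

Lemma preserving_sg f : (forall x, `|f x| <= 1) -> preserving f ->
  preserving (fun x => Num.sg (f x)).
Proof.
move=> f1 pf; apply: (@preserving_lim (fun k x => iter k (@steepen R) (f x)) _ 1).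
- by move=> k; exact: preserving_iter_steepen.
- by move=> k x; elim: k => //= k; exact: steepen_itv.
- by move=> x; apply: steepen_cvg.
Qed.

(** The sign of sin ((x - a) / n) is that of x - a once n exceeds |x - a|. *)
Lemma preserving_sg_shift a : preserving (fun x => Num.sg (x - a)).
Proof.
apply: (@preserving_lim (fun n x => Num.sg (sin (n.+1%:R^-1 * (x - a)))) _ 1).
- move=> n; apply: preserving_sg => [x|]; first exact: sin_max.
  exact: preserving_sin.
- by move=> n x; exact: sg_le1.
- move=> x; apply: cvg_near_cst; near=> n.
  rewrite sin_sg; first by rewrite sgrM gtr0_sg ?mul1r// invr_gt0.
  rewrite normrM ger0_norm ?invr_ge0// ler_pdivrMl// mulr1.
  rewrite (le_trans (ltW (truncnS_gt _)))// ler_nat ltnS.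
  by near: n; exact: nbhs_infty_ge.
Unshelve. all: by end_near. Qed.

Lemma preserving_indic_ray a : preserving \1_(`]-oo, a[%classic).
Proof.
apply: (@eq_preserving (fun x => 2^-1 * (Num.sg (x - a) * Num.sg (x - a)) +
   - 2^-1 * Num.sg (x - a))).
  have mem_ray x : (x \in `]-oo, a[%classic) = (x < a).
    by apply/idP/idP; rewrite inE /= in_itv.
  move=> x; rewrite indicE mem_ray -subr_lt0; by case: (sgrP (x - a)) => _ /=; field.
by apply: preservingD; apply: preservingZ; do ?apply: preservingM;
   exact: preserving_sg_shift.
Qed.

Lemma preserving_indicC B : preserving \1_B -> preserving \1_(~` B).
Proof.
move=> pB; apply: (@eq_preserving (fun x => 1 + -1 * \1_B x)).
  by move=> x; rewrite !indicE in_setC; case: (x \in B) => /=; ring.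
by apply: preservingD (preservingZ _ pB); exact: preserving_cst.
Qed.

Lemma preserving_indicU A B : preserving \1_A -> preserving \1_B ->
  preserving \1_(A `|` B).
Proof.
move=> pA pB.
apply: (@eq_preserving (fun x => \1_A x + (\1_B x + -1 * (\1_A x * \1_B x)))).
  by move=> x; rewrite !indicE in_setU; case: (x \in A); case: (x \in B) => /=; ring.
by do ?[apply: preservingD => //]; apply: preservingZ; exact: preservingM.
Qed.

(** Half-lines generate the Borel sets, and the sets with a preserving indicator
    are stable under complements and countable unions. For polynomials equal to
    1 this is moment determinacy in one dimension, with weights. *)
Lemma preserving_indic B : measurable B -> preserving \1_B.
Proof.
have RE : @measurable _ R = <<s @RGenInftyO.G R >> by exact: RGenInftyO.measurableE.
rewrite RE; apply: (@dynkin_induction _ _ _ (fun S => preserving \1_S) RE) => //.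
- move=> _ _ [x ->] [y ->]; exists (Order.min x y); apply/seteqP; split=> z /=.
    by rewrite !in_itv/= lt_min => -[-> ->].
  by rewrite !in_itv/= lt_min => /andP[].
- by rewrite indicT; exact: preserving_cst.
- by move=> _ [x ->]; exact: preserving_indic_ray.
- by move=> S _; exact: preserving_indicC.
- move=> F _ _ pF.
  apply: (@preserving_lim (fun n => \1_(\big[setU/set0]_(i < n) F i)) _ 1).
  + elim=> [|n ihn]; first by rewrite big_ord0 indic0; exact: preserving_cst.
    by rewrite big_ord_recr; exact: preserving_indicU.
  + by move=> n x; exact: norm_indic_le1.
  + move=> x; apply: cvg_near_cst.
    have [[k _ Fkx]|Fx] := pselect ((\bigcup_k F k) x).
      near=> n; rewrite !indicE !mem_set//; first by exists k.
      rewrite -bigcup_mkord; exists k => //=.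
      by near: n; exact: nbhs_infty_gt.
    near=> n; rewrite !indicE !memNset// -bigcup_mkord => -[k _ Fkx].
    by apply: Fx; exists k.
Unshelve. all: by end_near. Qed.

End PreservingFunctions.

(** * Stationary processes and their sigma-algebras *)

Section Recurrence.
Context (R : realType).

(** The equation e_{k+1} = a (e_k + e_{k+2}) with 2|a| < 1 contracts the
    supremum norm of a bounded sequence once the initial value vanishes. *)
Lemma bounded_recurrence0 (a M : R) (e : nat -> R) : 2 * `|a| < 1 ->
  e 0%N = 0 -> (forall k, e k.+1 = a * (e k + e k.+2)) ->
  (forall k, `|e k| <= M) -> forall k, e k = 0.
Proof.
move=> a1 e0 erec eM k.
have decay n : forall k, `|e k| <= (2 * `|a|) ^+ n * M.
  elim: n => [k'|n ihn [|k']]; first by rewrite expr0 mul1r.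
    by rewrite e0 normr0 mulr_ge0 ?exprn_ge0 ?mulr_ge0// (le_trans _ (eM 0%N)).
  rewrite erec normrM; apply: (@le_trans _ _ (`|a| * (`|e k'| + `|e k'.+2|))).
    by rewrite ler_wpM2l// ler_normD.
  apply: le_trans (ler_wpM2l (normr_ge0 a) (lerD (ihn k') (ihn k'.+2))) _.
  by rewrite exprS le_eqVlt; apply/orP; left; apply/eqP; ring.
apply/eqP; rewrite -normr_le0.
have lim0 : (fun n => (2 * `|a|) ^+ n * M) @ \oo --> (0 : R).
  rewrite -[X in _ --> X](mul0r M); apply: cvgMl.
  by apply: cvg_expr; rewrite ger0_norm// mulr_ge0.
rewrite -(cvg_lim (@Rhausdorff R) lim0); apply: limr_ge.
  by apply/cvg_ex; exists 0.
by near=> n.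
Unshelve. all: by end_near. Qed.

End Recurrence.

Section SameLaw.
Context d (T : measurableType d) (R : realType) (P : probability T R).
Context d' (S : measurableType d').

Lemma mean_same_law (U V : T -> S) (F : S -> R) :
  measurable_fun setT U -> measurable_fun setT V -> measurable_fun setT F ->
  (forall B, measurable B -> P (U @^-1` B) = P (V @^-1` B)) ->
  integ P (F \o U) -> integ P (F \o V) ->
  mean P (F \o U) = mean P (F \o V).
Proof.
move=> mU mV mF UV iU iV.
have mFE : measurable_fun setT (EFin \o F) by exact/measurable_EFinP.
rewrite /mean /Rintegral; congr fine.
have := @integral_pushforward _ _ _ _ R U mU P setT (EFin \o F) mFE iU measurableT.
have := @integral_pushforward _ _ _ _ R V mV P setT (EFin \o F) mFE iV measurableT.
rewrite !preimage_setT => <- <-.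
by apply: eq_measure_integral => B mB _; exact: UV.
Qed.

End SameLaw.

Section MeasurableOn.
Context d (T : measurableType d) (R : realType) (P : probability T R).
Variable X : int -> {RV P >-> R}.
Implicit Types (J : set int) (Z : T -> R).

Definition adapted J Z : Prop := measurable_wrt (sigma_of X J) Z.

Lemma sigma_of_measurable J A : sigma_of X J A -> measurable A.
Proof.
apply: smallest_sub; first exact: sigma_algebra_measurable.
by move=> _ [j _ [B mB <-]]; exact: measurable_funP.
Qed.

Lemma sigma_of_sub J J' : J `<=` J' -> sigma_of X J `<=` sigma_of X J'.
Proof. move=> JJ'; apply: sub_smallest2r; first exact: smallest_sigma_algebra.
exact: bigcup_subset. Qed.

Lemma adapted_sub J J' Z : J `<=` J' -> adapted J Z -> adapted J' Z.
Proof. by move=> JJ' mZ B mB; apply: sigma_of_sub JJ' _ _; exact: mZ. Qed.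

Lemma adapted_X J j : J j -> adapted J (X j).
Proof.
move=> Jj B mB; apply: sub_gen_smallest; exists j => //.
by exists B => //; rewrite setTI.
Qed.

Lemma adapted_meas J Z : adapted J Z -> measurable_fun setT Z.
Proof. by apply: measurable_wrt_fun => A; exact: sigma_of_measurable. Qed.

Lemma adapted_comp J Z (f : R -> R) : measurable_fun setT f -> adapted J Z ->
  adapted J (fun w => f (Z w)).
Proof.
move=> mf /measurable_wrtP mZ; apply/measurable_wrtP; exact: measurableT_comp.
Qed.

Lemma adapted_cst J c : adapted J (fun=> c).
Proof. by apply/measurable_wrtP. Qed.

Lemma adaptedM J Z Z' : adapted J Z -> adapted J Z' ->
  adapted J (fun w => Z w * Z' w).
Proof.
move=> /measurable_wrtP mZ /measurable_wrtP mZ'; apply/measurable_wrtP.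
exact: measurable_funM.
Qed.

Lemma adapted_indic J A : sigma_of X J A -> adapted J \1_A.
Proof. by move=> JA; apply/measurable_wrtP; exact: measurable_indic. Qed.

Lemma adapted_horner J Z (p : {poly R}) : adapted J Z -> adapted J (fun w => p.[Z w]).
Proof.
move=> mZ; apply: (adapted_comp (f := horner p)) => //.
by apply: continuous_measurable_fun => x; exact: continuous_horner.
Qed.

Lemma adapted_test J (V L Z : T -> R) :
  cond_exp_ae P (sigma_of X J) V L -> integ P L -> adapted J Z ->
  integ P (fun w => Z w * V w) -> integ P (fun w => Z w * L w) ->
  mean P (fun w => Z w * V w) = mean P (fun w => Z w * L w).
Proof. exact: (cond_exp_test (@sigma_of_measurable J)). Qed.

Lemma adapted_orthogonal J (U Z : T -> R) : integ P U ->
  (forall A, sigma_of X J A -> mean P (fun w => \1_A w * U w) = 0) ->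
  adapted J Z -> integ P (fun w => Z w * U w) ->
  mean P (fun w => Z w * U w) = 0.
Proof. exact: (orthogonal_measurable (@sigma_of_measurable J)). Qed.

End MeasurableOn.

Section StationaryProcess.
Context d (T : measurableType d) (R : realType) (P : probability T R).
Variable X : int -> {RV P >-> R}.

Lemma measurable_coordinates n (k : 'I_n -> int) :
  measurable_fun setT (fun w => [tuple X (k i) w | i < n]).
Proof.
apply/measurable_fun_tnthP => i; rewrite /comp.
under eq_fun do rewrite tnth_mktuple.
exact: measurable_funP.
Qed.

Lemma stationary_mean n (k : 'I_n -> int) (h : int) (F : n.-tuple R -> R) :
  strictly_stationary X -> measurable_fun setT F ->
  integ P (fun w => F [tuple X (k i + h) w | i < n]) ->
  integ P (fun w => F [tuple X (k i) w | i < n]) ->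
  mean P (fun w => F [tuple X (k i + h) w | i < n]) =
  mean P (fun w => F [tuple X (k i) w | i < n]).
Proof.
move=> sX mF i1 i2.
apply: (mean_same_law (measurable_coordinates _) (measurable_coordinates _) mF)
  => // B mB; exact: sX.
Qed.

Lemma stationary_mean1 (f : R -> R) j h : strictly_stationary X ->
  measurable_fun setT f -> integ P (fun w => f (X j w)) ->
  integ P (fun w => f (X (j + h) w)) ->
  mean P (fun w => f (X (j + h) w)) = mean P (fun w => f (X j w)).
Proof.
move=> sX mf i1 i2.
have := @stationary_mean 1 (fun=> j) h (fun t => f (tnth t ord0)) sX.
have E h' : (fun w => f (tnth [tuple X h' w | _ < 1] ord0)) = (fun w => f (X h' w)).
  by apply/funext => w; rewrite tnth_mktuple.
rewrite !E; apply=> //; apply: measurableT_comp => //; exact: measurable_tnth.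
Qed.

Lemma stationary_mean2 i j h : strictly_stationary X ->
  (forall k l, integ P (fun w => X k w * X l w)) ->
  mean P (fun w => X (i + h) w * X (j + h) w) =
  mean P (fun w => X i w * X j w).
Proof.
move=> sX iX.
have := @stationary_mean 2 (fun l => if l == ord0 then i else j) h
  (fun t => tnth t ord0 * tnth t ord_max) sX.
have E h' : (fun w => tnth [tuple X ((if l == ord0 then i else j) + h') w | l < 2] ord0 *
    tnth [tuple X ((if l == ord0 then i else j) + h') w | l < 2] ord_max) =
    (fun w => X (i + h') w * X (j + h') w).
  by apply/funext => w; rewrite !tnth_mktuple.
have E0 : (fun w => tnth [tuple X (if l == ord0 then i else j) w | l < 2] ord0 *
    tnth [tuple X (if l == ord0 then i else j) w | l < 2] ord_max) =
    (fun w => X i w * X j w).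
  by apply/funext => w; rewrite !tnth_mktuple.
rewrite E E0; apply => //.
by apply: measurable_funM; exact: measurable_tnth.
Qed.

End StationaryProcess.

Section TimeReversal.
Context d (T : measurableType d) (R : realType) (P : probability T R).
Variable X : int -> {RV P >-> R}.

Definition reversed (k : int) : {RV P >-> R} := X (- k).

Lemma sigma_of_reversed (J : set int) :
  sigma_of reversed J = sigma_of X [set j | J (- j)].
Proof.
rewrite /sigma_of; congr (<<s _ >>); apply/seteqP; split=> A [j Jj hA].
  by exists (- j) => //=; rewrite opprK.
by exists (- j) => //; rewrite /reversed opprK.
Qed.

(** The hypotheses are symmetric in time, so that every statement about the past
    has a twin about the future. *)
Lemma reversed_field (a b A B C D : R) :
  quadratic_regression_field X a b A B C D ->
  (forall k l, integ P (fun w => X k w * X l w)) ->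
  quadratic_regression_field reversed a b A B C D /\
  autocorr reversed 1 = autocorr X 1.
Proof.
move=> hX iXX; have sX := qrf_stationary hX.
have acE k : autocorr X k = mean P (fun w => X 0 w * X k w).
  by rewrite /autocorr unlock.
have rE k : autocorr reversed k = autocorr X k.
  have -> : autocorr reversed k = mean P (fun w => X 0 w * X (- k) w).
    by rewrite /autocorr unlock /reversed oppr0.
  rewrite acE -(stationary_mean2 0 (- k) k sX iXX) add0r addNr.
  by apply: eq_mean => w; rewrite mulrC.
have othersE k : sigma_of reversed [set j | j != k] =
    sigma_of X [set j | j != - k].
  rewrite sigma_of_reversed; congr (sigma_of X _).
  by apply/seteqP; split=> j /=; rewrite eqr_oppLR.
split; last exact: rE.
split; rewrite ?rE.
- move=> n k h S mS; rewrite -[RHS](sX n (fun i => - k i) (- h) S mS).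
  rewrite /fdd /reversed; congr (P _); apply/funext => w /=; congr S.
  by apply: eq_from_tnth => i; rewrite !tnth_mktuple opprD.
- by move=> k; exact: (qrf_square_integrable hX).
- by move=> k; exact: (qrf_mean hX).
- by move=> k; exact: (qrf_second_moment hX).
- exact: (qrf_r_neq0 hX).
- exact: (qrf_r_bound hX).
- move=> k; rewrite othersE; have := qrf_linear hX (- k).
  congr cond_exp_ae; apply/funext => w; rewrite /reversed opprB opprD.
  have -> : 1 - k = - k + 1 by rewrite addrC.
  by rewrite /sym_linear [X (- k - 1) w + _]addrC.
- move=> k; rewrite othersE; have := qrf_quadratic hX (- k).
  congr cond_exp_ae; apply/funext => w.
  rewrite /reversed opprB opprD; have -> : 1 - k = - k + 1 by rewrite addrC.
  by rewrite /sym_quadratic; ring.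
- exact: (qrf_D hX).
- exact: (qrf_AB hX).
- exact: (qrf_A_lower hX).
- exact: (qrf_A_upper hX).
Qed.

End TimeReversal.

(** * One-sided regressions *)

Section SecondOrder.
Context d (T : measurableType d) (R : realType) (P : probability T R).
Variable X : int -> {RV P >-> R}.
Variables a b A B C D : R.
Hypothesis hX : quadratic_regression_field X a b A B C D.
Local Notation r := (autocorr X 1).
Local Notation E := (mean P).
Local Notation past k := [set j : int | j <= k].
Local Notation others k := [set j : int | j != k].

Lemma integ_sqr k : integ P (fun w => X k w ^+ 2).
Proof. exact: Lfun2_integrable_sqr (qrf_square_integrable hX k). Qed.

Lemma integ_XX k l : integ P (fun w => X k w * X l w).
Proof. apply: integM => //; exact: integ_sqr. Qed.

Lemma integ_X k : integ P (X k).
Proof.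
have := @integM _ _ _ P (fun=> 1) (X k) _ _ _ (integ_sqr k).
move=> /(_ _ _ _)/eq_integ; apply => //; first by move=> w; rewrite mul1r.
exact: integ_cst.
Qed.

Lemma mean_X k : E (X k) = 0.
Proof. by have := qrf_mean hX k; rewrite unlock /mean /Rintegral => ->. Qed.

Lemma mean_sqr k : E (fun w => X k w ^+ 2) = 1.
Proof. by have := qrf_second_moment hX k; rewrite unlock /mean /Rintegral => ->. Qed.

Lemma autocorrE k : autocorr X k = E (fun w => X 0 w * X k w).
Proof. by rewrite /autocorr unlock. Qed.

Lemma mean_XX i j : E (fun w => X i w * X j w) = autocorr X (j - i).
Proof.
have sX := qrf_stationary hX.
rewrite autocorrE -(stationary_mean2 0 (j - i) i sX integ_XX).
by rewrite add0r subrK.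
Qed.

Lemma integ_sym_linear k : integ P
  (fun w => sym_linear a b (X (k - 1) w) (X (k + 1) w)).
Proof.
apply: integD; last exact: integ_cst.
by apply: integZ; apply: integD; exact: integ_X.
Qed.

Lemma integ_sym_quadratic k : integ P
  (fun w => sym_quadratic A B C D (X (k - 1) w) (X (k + 1) w)).
Proof.
repeat apply: integD; try (apply: integZ; try apply: integD).
all: try exact: integ_sqr.
all: try exact: integ_XX.
all: try exact: integ_X.
exact: integ_cst.
Qed.

Lemma b_eq0 : b = 0.
Proof.
have := adapted_test (qrf_linear hX 0) (integ_sym_linear 0)
  (@adapted_cst _ _ _ _ X (others 0) 1).
have E1 (f : T -> R) : (fun w => 1 * f w) = f by apply/funext => w; rewrite mul1r.
rewrite !E1 => /(_ (integ_X 0) (integ_sym_linear 0)).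
rewrite mean_X meanD; [|by apply: integZ; apply: integD; exact: integ_X|exact: integ_cst].
rewrite mean_cst meanZ; last by apply: integD; exact: integ_X.
by rewrite meanD ?mean_X ?addr0 ?mulr0 ?add0r//; exact: integ_X.
Qed.

Lemma linear_test k Z : adapted X (others k) Z ->
  integ P (fun w => Z w * X k w) -> integ P (fun w => Z w * X (k - 1) w) ->
  integ P (fun w => Z w * X (k + 1) w) ->
  E (fun w => Z w * X k w) =
  a * (E (fun w => Z w * X (k - 1) w) + E (fun w => Z w * X (k + 1) w)).
Proof.
move=> mZ i0 i1 i2.
have ZL w : Z w * sym_linear a b (X (k - 1) w) (X (k + 1) w) =
   a * (Z w * X (k - 1) w + Z w * X (k + 1) w).
  by rewrite /sym_linear b_eq0; ring.
have iZL : integ P (fun w => a * (Z w * X (k - 1) w + Z w * X (k + 1) w)).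
  by apply: integZ; exact: integD.
rewrite (adapted_test (qrf_linear hX k) (integ_sym_linear k) mZ i0).
  by rewrite (eq_mean _ ZL) meanZ ?meanD//; exact: integD.
by apply: eq_integ iZL => w; rewrite ZL.
Qed.

Lemma quadratic_test k Z : adapted X (others k) Z -> integ P Z ->
  integ P (fun w => Z w * X k w ^+ 2) ->
  integ P (fun w => Z w * X (k - 1) w ^+ 2) ->
  integ P (fun w => Z w * X (k + 1) w ^+ 2) ->
  integ P (fun w => Z w * (X (k - 1) w * X (k + 1) w)) ->
  E (fun w => Z w * X k w ^+ 2) =
  A * (E (fun w => Z w * X (k - 1) w ^+ 2) + E (fun w => Z w * X (k + 1) w ^+ 2)) +
  B * E (fun w => Z w * (X (k - 1) w * X (k + 1) w)) + C * E Z.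
Proof.
move=> mZ iZ i0 i1 i2 i12.
have D0 := qrf_D hX.
have ZQ w : Z w * sym_quadratic A B C D (X (k - 1) w) (X (k + 1) w) =
   A * (Z w * X (k - 1) w ^+ 2 + Z w * X (k + 1) w ^+ 2) +
   B * (Z w * (X (k - 1) w * X (k + 1) w)) + C * Z w.
  by rewrite /sym_quadratic D0; ring.
have j1 := integZ A (integD i1 i2); have j2 := integZ B i12.
have j3 := integZ C iZ; have j4 := integD j1 j2.
rewrite (adapted_test (qrf_quadratic hX k) (integ_sym_quadratic k) mZ i0).
  rewrite (eq_mean _ ZQ) meanD// meanD// !meanZ// ?meanD//; exact: integD.
by apply: eq_integ (integD j4 j3) => w; rewrite ZQ.
Qed.

Lemma past_others k l Z : k < l -> adapted X (past k) Z -> adapted X (others l) Z.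
Proof.
by move=> kl; apply: adapted_sub => j /= jk; rewrite lt_eqF// (le_lt_trans jk).
Qed.

Lemma autocorr0 : autocorr X 0 = 1.
Proof.
by rewrite autocorrE -(mean_sqr 0); apply: eq_mean => w; rewrite expr2.
Qed.

Lemma autocorr_recurrence (k : nat) :
  autocorr X (Posz k.+1) = a * (autocorr X (Posz k) + autocorr X (Posz k.+2)).
Proof.
have mX0 : adapted X (others (Posz k.+1)) (X 0) by exact: adapted_X.
have := linear_test mX0 (integ_XX _ _) (integ_XX _ _) (integ_XX _ _).
rewrite !mean_XX !subr0.
by rewrite (_ : Posz k.+1 - 1 = k)%R 1?(_ : Posz k.+1 + 1 = k.+2)%R//; lia.
Qed.

Lemma autocorr_le1 k : `|autocorr X k| <= 1.
Proof.
rewrite autocorrE; apply: le_trans (mean_abs (integ_XX _ _)) _.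
have -> : 1 = E (fun w => 2^-1 * (X 0 w ^+ 2 + X k w ^+ 2)).
  rewrite (meanZ _ (integD (integ_sqr _) (integ_sqr _))).
  by rewrite (meanD (integ_sqr _) (integ_sqr _)) !mean_sqr; field.
apply: le_mean; first exact: integ_abs (integ_XX _ _).
  exact: integZ (integD (integ_sqr _) (integ_sqr _)).
move=> w; rewrite normrM -(real_normK (num_real (X 0 w))).
rewrite -(real_normK (num_real (X k w))).
by have := sqr_ge0 (`|X 0 w| - `|X k w|); lra.
Qed.

(** The hypothesis 2 |r| < 1 + r_2 is a bound on a = r / (1 + r_2). *)
Lemma double_norm_a : 2 * `|a| < 1.
Proof.
have := autocorr_recurrence 0; rewrite autocorr0 => ra.
have := qrf_r_bound hX; rewrite ra normrM => h.
have p0 : 0 < 1 + autocorr X 2 by apply: le_lt_trans h; rewrite !mulr_ge0.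
move: h; rewrite (gtr0_norm p0) mulrA -[ltRHS]mul1r.
by rewrite ltr_pM2r.
Qed.

(** The correlations solve a recurrence with two exponential solutions, one of
    them unbounded, which leaves the geometric sequence. *)
Lemma autocorrX (k : nat) : autocorr X (Posz k) = r ^+ k.
Proof.
have e0 j : autocorr X (Posz j.+1) - r * autocorr X (Posz j) = 0.
  apply: (@bounded_recurrence0 _ a 2
    (fun j => autocorr X (Posz j.+1) - r * autocorr X (Posz j)) double_norm_a).
  - by rewrite autocorr0 mulr1 subrr.
  - move=> k'; transitivity (a * (autocorr X k'.+1 + autocorr X k'.+3) -
      r * (a * (autocorr X k' + autocorr X k'.+2))); last by ring.
    by rewrite -!autocorr_recurrence.
  - move=> k'; apply: le_trans (ler_normB _ _) _; rewrite normrM.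
    have := autocorr_le1 (Posz k'.+1); have := autocorr_le1 (Posz k').
    have := autocorr_le1 1; have := normr_ge0 r.
    have := normr_ge0 (autocorr X k').
    by move=> *; nra.
elim: k => [|k ihk]; first by rewrite autocorr0.
by rewrite exprS -ihk; apply/eqP; rewrite -subr_eq0 e0.
Qed.

(** By Cauchy-Schwarz |r| <= 1, and |r| = 1 would contradict
    2 |r| < 1 + r ^+ 2. *)
Lemma r_sqr_lt1 : r ^+ 2 < 1.
Proof.
have := qrf_r_bound hX; have := autocorr_le1 1; rewrite (autocorrX 2).
rewrite -(real_normK (num_real r)); have := normr_ge0 r.
move: `|r| => x x0 x1 h; have x1' : x < 1.
  by rewrite lt_neqAle x1 andbT; apply/eqP => xE; move: h; rewrite xE; lra.
by nra.
Qed.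

Lemma r_neq0 : r != 0. Proof. exact: qrf_r_neq0 hX. Qed.

Lemma linear_coef : a * (1 + r ^+ 2) = r.
Proof. by rewrite -(autocorrX 2) [RHS](autocorr_recurrence 0) autocorr0. Qed.

Lemma quadratic_constant : C = 1 - 2 * A - B * r ^+ 2.
Proof.
have E1 (f : T -> R) : (fun w => 1 * f w) = f by apply/funext => w; rewrite mul1r.
have := quadratic_test (@adapted_cst _ _ _ _ X (others 0) 1) (integ_cst P 1).
rewrite !E1 => /(_ (integ_sqr _) (integ_sqr _) (integ_sqr _) (integ_XX _ _)).
rewrite !mean_sqr mean_XX mean_cst (_ : 0 + 1 - (0 - 1) = Posz 2)// autocorrX.
by move=> h; lra.
Qed.

Lemma B_relation : B * r ^+ 2 = r ^+ 2 - A * r ^+ 4 - A.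
Proof.
have -> : B = 1 - A * (r ^+ 2 + 1 / r ^+ 2).
  by apply/esym/eqP; rewrite subr_eq addrC eq_sym (qrf_AB hX).
by field; exact: r_neq0.
Qed.

(** This is where the upper bound on [A] makes the linear equations of the
    quadratic regression solvable. *)
Lemma regression_gap : 0 < 1 - A * (1 + r ^+ 2).
Proof.
have r4 : 0 < 1 + r ^+ 4 by rewrite ltr_wpDr// (exprM _ 2 2) sqr_ge0.
have := qrf_A_upper hX; rewrite ler_pdivlMr// => hA.
have := r_sqr_lt1; rewrite -(pmulr_rgt0 _ r4).
have -> : (1 + r ^+ 4) * (1 - A * (1 + r ^+ 2)) =
  (1 + r ^+ 4) - (A * (1 + r ^+ 4)) * (1 + r ^+ 2) by ring.
move: (A * (1 + r ^+ 4)) hA => y; rewrite (exprM _ 2 2).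
by have := sqr_ge0 r; move: (r ^+ 2) => x *; nra.
Qed.

(** The means of [X (k + j)] and of [r ^+ j * X k] over a past event solve the
    same recurrence, agree for j = 0 and stay bounded, hence agree. *)
Lemma linear_past_indic k A' : sigma_of X (past k) A' ->
  E (fun w => \1_A' w * X (k + 1) w) = r * E (fun w => \1_A' w * X k w).
Proof.
move=> pA.
have mA := adapted_indic pA.
have iA l : integ P (fun w => \1_A' w * X l w).
  by apply: integ_indicM (integ_X _); exact: sigma_of_measurable pA.
pose m j := E (fun w => \1_A' w * X (k + Posz j) w).
have m_rec j : m j.+1 = a * (m j + m j.+2).
  rewrite /m; have mA' : adapted X (others (k + Posz j.+1)) \1_A'.
    by apply: past_others mA; rewrite ltrDl.
  rewrite (linear_test mA' (iA _) (iA _) (iA _)).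
  by rewrite (_ : k + Posz j.+1 - 1 = k + j)%R 1?(_ : k + Posz j.+1 + 1 = k + j.+2)%R//; lia.
have m_le j : `|m j| <= 1.
  apply: le_trans (mean_abs (iA _)) _.
  rewrite -[leRHS](mean_sqr k).
  have -> : E (fun w => X k w ^+ 2) =
      E (fun w => 2^-1 * (1 + X (k + Posz j) w ^+ 2)).
    rewrite (meanZ _ (integD (integ_cst P 1) (integ_sqr _))).
    by rewrite (meanD (integ_cst P 1) (integ_sqr _)) !mean_sqr mean_cst; field.
  apply: le_mean; first exact: integ_abs.
    exact: integZ (integD (integ_cst _ _) (integ_sqr _)).
  move=> w; rewrite normrM -(real_normK (num_real (X _ w))).
  have := norm_indic_le1 R A' w; have := normr_ge0 (\1_A' w : R).
  have := sqr_ge0 (1 - `|X (k + Posz j) w|); have := normr_ge0 (X (k + Posz j) w).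
  by move=> *; nra.
apply/eqP; rewrite -subr_eq0; apply/eqP.
have := @bounded_recurrence0 _ a 2
  (fun j => m j - r ^+ j * m 0%N) double_norm_a _ _ _ 1%N.
rewrite /m expr1 addr0; apply => [|j|j]; first by rewrite expr0 mul1r subrr.
- rewrite -/(m j.+1) -/(m j) -/(m j.+2) m_rec.
  have -> : r ^+ j.+1 = a * (r ^+ j + r ^+ j.+2).
    transitivity (r ^+ j * (a * (1 + r ^+ 2))); first by rewrite linear_coef exprSr.
    by have := exprD r j 2; rewrite addn2 => ->; ring.
  by ring.
- apply: le_trans (ler_normB _ _) _; rewrite -/(m j) normrM normrX.
  have := m_le j; have := m_le 0%N; rewrite /m addr0 => m0 mj.
  have rj : `|r| ^+ j <= 1 by apply: exprn_ile1 => //; exact: autocorr_le1.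
  have := normr_ge0 (E (fun w => \1_A' w * X k w)).
  have : 0 <= `|r| ^+ j by exact: exprn_ge0.
  by move=> *; nra.
Qed.

Lemma linear_past k Z : adapted X (past k) Z ->
  integ P (fun w => Z w * X (k + 1) w) -> integ P (fun w => Z w * X k w) ->
  E (fun w => Z w * X (k + 1) w) = r * E (fun w => Z w * X k w).
Proof.
move=> mZ i1 i0; apply/eqP; rewrite -subr_eq0 -meanZ// -meanB//; last exact: integZ.
have ZE (W : T -> R) w :
    W w * X (k + 1) w - r * (W w * X k w) = W w * (X (k + 1) w - r * X k w).
  by ring.
under eq_mean do rewrite ZE.
apply/eqP; apply: (adapted_orthogonal (X := X) (J := past k)) => //.
- by apply: integB; [exact: integ_X|apply: integZ; exact: integ_X].
- move=> A' pA; have mA := adapted_indic pA.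
  have iA l : integ P (fun w => \1_A' w * X l w).
    by apply: integ_indicM (integ_X _); exact: sigma_of_measurable pA.
  under eq_mean do rewrite -ZE.
  rewrite meanB ?meanZ//; last exact: integZ.
  by rewrite linear_past_indic// subrr.
- by apply: eq_integ (integB i1 (integZ r i0)) => w; rewrite ZE.
Qed.

(** With v_j the mean of X_{k+j}^2 over the event, the mean of X_{k+1} X_{k+2}
    computed by conditioning on the past and on the other variables gives
    v_2 = (1 + r^2) v_1 - r^2 v_0; the quadratic regression at k + 1 is a second
    equation, and the two determine v_1. *)
Lemma quadratic_past_indic k A' : sigma_of X (past k) A' ->
  E (fun w => \1_A' w * X (k + 1) w ^+ 2) =
  r ^+ 2 * E (fun w => \1_A' w * X k w ^+ 2) + (1 - r ^+ 2) * E \1_A'.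
Proof.
move=> pA; have mA := adapted_indic pA.
have k1 : k + 1 + 1 = k + 2 by rewrite -addrA.
have k0 : k + 1 - 1 = k by rewrite addrK.
have iA (f : T -> R) : integ P f -> integ P (fun w => \1_A' w * f w).
  by apply: integ_indicM; exact: sigma_of_measurable pA.
have iXX k' l' : integ P (fun w => \1_A' w * X k' w * X l' w).
  by apply: eq_integ (iA _ (integ_XX k' l')) => w; rewrite mulrA.
have sqE (l : int) : E (fun w => \1_A' w * X l w * X l w) =
    E (fun w => \1_A' w * X l w ^+ 2).
  by apply: eq_mean => w; rewrite expr2 mulrA.
have mulE (l m : int) : E (fun w => \1_A' w * X l w * X m w) =
    E (fun w => \1_A' w * X m w * X l w).
  by apply: eq_mean => w; rewrite mulrAC.
have past1 : past k `<=` past (k + 1) by move=> j /= jk; rewrite (le_trans jk)// lerDl.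
have mA1 := adapted_sub past1 mA.
have mX1 : adapted X (past (k + 1)) (X (k + 1)) by apply: adapted_X => /=.
have mX0 : adapted X (past k) (X k) by apply: adapted_X => /=.
have c1 := linear_past (adaptedM mA1 mX1) (iXX _ _) (iXX _ _).
have c0 := linear_past (adaptedM mA1 (adapted_sub past1 mX0)) (iXX _ _) (iXX _ _).
have c2 := linear_past (adaptedM mA mX0) (iXX _ _) (iXX _ _).
have mo : adapted X (others (k + 1)) (fun w => \1_A' w * X (k + 2) w).
  apply: adaptedM; first by apply: past_others mA; rewrite ltrDl.
  by apply: adapted_X => /=; rewrite (inj_eq (addrI k)).
have c3 := linear_test mo (iXX _ _) (iXX _ _) (iXX _ _).
have mo1 : adapted X (others (k + 1)) \1_A' by apply: past_others mA; rewrite ltrDl.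
have mA0 : integ P \1_A' by apply: integ_indic; exact: sigma_of_measurable pA.
have c4 := quadratic_test mo1 mA0 (iA _ (integ_sqr _))
  (iA _ (integ_sqr _)) (iA _ (integ_sqr _)) (iA _ (integ_XX _ _)).
rewrite ?k1 ?k0 in c0 c1 c3 c4.
have cw : E (fun w => \1_A' w * (X k w * X (k + 2) w)) =
    E (fun w => \1_A' w * X k w * X (k + 2) w).
  by apply: eq_mean => w; rewrite mulrA.
move: c4; rewrite cw c0 c2 -!sqE => c4.
move: c3; rewrite mulE c1 [E (fun w => _ * X (k + 2) w * X k w)]mulE c0 c2 => c3.
apply: (mulIf (lt0r_neq0 regression_gap)).
move: c3 c4.
move: (E (fun w => _ * X k w * X k w)) => v0.
move: (E (fun w => _ * X (k + 1) w * X (k + 1) w)) => v1.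
move: (E (fun w => _ * X (k + 2) w * X (k + 2) w)) => v2.
move: (E \1_A') => e c3 c4.
have v2E : v2 = (1 + r ^+ 2) * v1 - r ^+ 2 * v0.
  apply: (mulfI r_neq0); rewrite -[X in X * v2]linear_coef.
  have -> : a * (1 + r ^+ 2) * v2 = (1 + r ^+ 2) * (a * v2) by ring.
  have -> : a * v2 = r * v1 - a * (r * (r * v0)) by rewrite c3; ring.
  transitivity ((1 + r ^+ 2) * (r * v1) - (a * (1 + r ^+ 2)) * (r * (r * v0))).
    by ring.
  by rewrite linear_coef; ring.
rewrite mulrBr mulr1 [X in X - _]c4 v2E quadratic_constant.
have -> : B * (r * (r * v0)) = (B * r ^+ 2) * v0 by ring.
by rewrite B_relation; ring.
Qed.

Lemma quadratic_past k Z : adapted X (past k) Z -> integ P Z ->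
  integ P (fun w => Z w * X (k + 1) w ^+ 2) ->
  integ P (fun w => Z w * X k w ^+ 2) ->
  E (fun w => Z w * X (k + 1) w ^+ 2) =
  r ^+ 2 * E (fun w => Z w * X k w ^+ 2) + (1 - r ^+ 2) * E Z.
Proof.
move=> mZ iZ i1 i0.
pose U w := X (k + 1) w ^+ 2 - (r ^+ 2 * X k w ^+ 2 + (1 - r ^+ 2)).
have ZU (W : T -> R) w : W w * X (k + 1) w ^+ 2 -
    (r ^+ 2 * (W w * X k w ^+ 2) + (1 - r ^+ 2) * W w) = W w * U w.
  by rewrite /U; ring.
have mean_ZU (W : T -> R) : integ P W ->
    integ P (fun w => W w * X (k + 1) w ^+ 2) ->
    integ P (fun w => W w * X k w ^+ 2) ->
    integ P (fun w => W w * U w) /\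
    E (fun w => W w * U w) = E (fun w => W w * X (k + 1) w ^+ 2) -
    (r ^+ 2 * E (fun w => W w * X k w ^+ 2) + (1 - r ^+ 2) * E W).
  move=> iW j1 j0; have j := integD (integZ (r ^+ 2) j0) (integZ (1 - r ^+ 2) iW).
  split; first by apply: eq_integ (integB j1 j) => w; rewrite ZU.
  rewrite -(eq_mean _ (ZU W)) (meanB j1 j).
  by rewrite (meanD (integZ (r ^+ 2) j0) (integZ (1 - r ^+ 2) iW)) !meanZ.
have [iZU EZU] := mean_ZU _ iZ i1 i0.
apply/eqP; rewrite -subr_eq0 -EZU; apply/eqP.
apply: (adapted_orthogonal (X := X) (J := past k)) => //.
  apply: integB; first exact: integ_sqr.
  by apply: integD; [exact: integZ (integ_sqr _)|exact: integ_cst].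
move=> A' pA; have mA := adapted_indic pA.
have iA (f : T -> R) : integ P f -> integ P (fun w => \1_A' w * f w).
  by apply: integ_indicM; exact: sigma_of_measurable pA.
have iA0 : integ P \1_A' by apply: integ_indic; exact: sigma_of_measurable pA.
have [_ ->] := mean_ZU _ iA0 (iA _ (integ_sqr _)) (iA _ (integ_sqr _)).
by rewrite quadratic_past_indic// subrr.
Qed.

(** The conditional variance of X_{k+1} given X_k is the constant 1 - r^2; its
    boundedness is what controls the moments. *)
Lemma residual_past k (phi : R -> R) c : measurable_fun setT phi ->
  (forall x, `|phi x| <= c) ->
  E (fun w => phi (X k w) * (X (k + 1) w - r * X k w) ^+ 2) =
  (1 - r ^+ 2) * E (fun w => phi (X k w)).
Proof.
move=> mphi phic.
have adapted_phi : adapted X (past k) (fun w => phi (X k w)).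
  by apply: adapted_comp => //; apply: adapted_X => /=.
have m_phi := adapted_meas adapted_phi.
have i_phi (f : T -> R) : integ P f -> integ P (fun w => phi (X k w) * f w).
  by move=> jf; apply: integ_mul_bounded jf.
have adapted_phiX : adapted X (past k) (fun w => phi (X k w) * X k w).
  by apply: adaptedM => //; apply: adapted_X => /=.
have iXX l : integ P (fun w => phi (X k w) * X k w * X l w).
  by apply: eq_integ (i_phi _ (integ_XX k l)) => w; rewrite mulrA.
have i1 : integ P (fun w => phi (X k w)) by exact: (@integ_bounded _ _ _ _ c).
have i2 l := i_phi _ (integ_sqr l).
have q := quadratic_past adapted_phi i1 (i2 _) (i2 _).
have l := linear_past adapted_phiX (iXX _) (iXX _).
have lE : E (fun w => phi (X k w) * X k w * X k w) =
    E (fun w => phi (X k w) * X k w ^+ 2).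
  by apply: eq_mean => w; rewrite expr2 mulrA.
have expand w : phi (X k w) * (X (k + 1) w - r * X k w) ^+ 2 =
    (phi (X k w) * X (k + 1) w ^+ 2 +
     - (2 * r) * (phi (X k w) * X k w * X (k + 1) w)) +
    r ^+ 2 * (phi (X k w) * X k w ^+ 2) by ring.
rewrite (eq_mean _ expand) meanD; last 2 first.
- exact: integD (i2 _) (integZ _ (iXX _)).
- exact: integZ (i2 _).
rewrite meanD//; last exact: integZ (iXX _).
by rewrite !meanZ// l lE q; ring.
Qed.
End SecondOrder.

(** * Finiteness of all moments *)

Section AllMoments.
Context d (T : measurableType d) (R : realType) (P : probability T R).
Variables (U V : T -> R) (r s : R).
Hypotheses (mU : measurable_fun setT U) (mV : measurable_fun setT V).
Hypotheses (iU : integ P (fun w => U w ^+ 2)) (iV : integ P (fun w => V w ^+ 2)).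
Hypotheses (r0 : r != 0) (r1 : r ^+ 2 < 1) (s0 : 0 <= s).

(** For M >= 0, a bounded substitute for x^(2n), nondecreasing in |x|. *)
Definition truncated_power (M : R) n (x : R) : R := (Num.min (x ^+ 2) M) ^+ n.

Lemma measurable_truncated_power M n : measurable_fun setT (truncated_power M n).
Proof.
apply: measurable_funX; apply: measurable_minr => //; exact: measurable_funX.
Qed.

Lemma truncated_power_itv M n x : 0 <= M -> 0 <= truncated_power M n x <= M ^+ n.
Proof.
move=> M0; have m0 : 0 <= Num.min (x ^+ 2) M by rewrite le_min sqr_ge0.
rewrite /truncated_power exprn_ge0//= lerXn2r ?nnegrE//.
by rewrite ge_min lexx orbT.
Qed.

(** If y is close to r x, relatively to x, then x - r y is close to
    (1 - r^2) x, hence comparable with x because r^2 < 1, and x is dominated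
    by y because r != 0. Otherwise the residual y - r x dominates x. *)
Lemma residual_domination : exists K, 0 <= K /\ exists k, 1 <= k /\
  forall x y, x ^+ 2 <= K * (y - r * x) ^+ 2 \/
    (x ^+ 2 <= K * (x - r * y) ^+ 2 /\ x ^+ 2 <= k * y ^+ 2).
Proof.
have r20 : 0 < r ^+ 2 by rewrite exprn_even_gt0.
(* closeness is measured by |y - r x| <= q |r| |x| with 2 q = 1 - r^2 *)
have [q [qE q0 q1]] : exists q, [/\ 1 - r ^+ 2 = 2 * q, 0 < q & q < 1 / 2].
  by exists ((1 - r ^+ 2) / 2); split; [field|move: r1; lra|move: r20; lra].
have e0 : 0 < q ^+ 2 * r ^+ 2 by rewrite mulr_gt0// exprn_gt0.
exists (q ^+ 2 * r ^+ 2)^-1; split; first by rewrite invr_ge0 ltW.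
exists (4 / r ^+ 2); split.
  by rewrite ler_pdivlMr//; lra.
move=> x y.
have [small|large] := leP ((y - r * x) ^+ 2) (q ^+ 2 * r ^+ 2 * x ^+ 2).
  right.
  have small' : `|y - r * x| <= q * `|r| * `|x|.
    rewrite -(ler_pXn2r (n := 2)) ?nnegrE ?mulr_ge0 ?(ltW q0)//.
    by rewrite !exprMn !real_normK// num_real.
  have rr : 0 < `|r| by rewrite normr_gt0.
  have rle1 : `|r| <= 1.
    by rewrite -(ler_pXn2r (n := 2)) ?nnegrE// expr1n real_normK ?num_real// ltW.
  split.
    have : q * `|x| <= `|x - r * y|.
      have -> : x - r * y = (1 - r ^+ 2) * x - r * (y - r * x) by ring.
      apply: le_trans (lerB_dist _ _); rewrite !normrM.
      have -> : `|1 - r ^+ 2| = 2 * q by rewrite ger0_norm// subr_ge0 ltW.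
      have : `|r| * `|y - r * x| <= 1 * (q * `|r| * `|x|) by apply: ler_pM.
      have : q * `|r| * `|x| <= q * 1 * `|x|.
        by rewrite ler_wpM2r// ler_wpM2l// ltW.
      by lra.
    move=> h; have {h} : (q * `|x|) ^+ 2 <= `|x - r * y| ^+ 2.
      by rewrite lerXn2r// nnegrE !mulr_ge0// ltW.
    rewrite exprMn !real_normK ?num_real// => h.
    rewrite ler_pdivlMl//; apply: le_trans h.
    rewrite -mulrA ler_wpM2l ?sqr_ge0// ler_piMl ?sqr_ge0// ltW//.
  have h : `|r| / 2 * `|x| <= `|y|.
    have -> : y = r * x + (y - r * x) by ring.
    apply: le_trans (lerB_normD _ _); rewrite normrM.
    have : q * `|r| * `|x| <= 1 / 2 * `|r| * `|x|.
      by rewrite !ler_wpM2r// ltW.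
    by lra.
  have {h} : (`|r| / 2 * `|x|) ^+ 2 <= `|y| ^+ 2.
    by rewrite lerXn2r// nnegrE !mulr_ge0// invr_ge0.
  rewrite !exprMn !real_normK ?num_real// => h.
  rewrite mulrAC ler_pdivlMr//; lra.
by left; rewrite ler_pdivlMl// ltW.
Qed.

Hypothesis same_law : forall (phi : R -> R) c, measurable_fun setT phi ->
  (forall x, `|phi x| <= c) -> mean P (phi \o U) = mean P (phi \o V).
Hypothesis residual_U : forall (phi : R -> R) c, measurable_fun setT phi ->
  (forall x, `|phi x| <= c) ->
  mean P (fun w => phi (U w) * (V w - r * U w) ^+ 2) = s * mean P (phi \o U).
Hypothesis residual_V : forall (phi : R -> R) c, measurable_fun setT phi ->
  (forall x, `|phi x| <= c) ->
  mean P (fun w => phi (V w) * (U w - r * V w) ^+ 2) = s * mean P (phi \o V).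

(** Linear regressions in both directions with bounded conditional variances
    force all moments to be finite: each bound on E|U|^2n gives one on
    E|U|^(2n+2), uniformly in the truncation. *)
Lemma regressions_all_moments : all_moments P U.
Proof.
have [K [K0 [k [k1 dom]]]] := residual_domination.
have k0 : 0 <= k by exact: le_trans k1.
apply: am_even => //; elim=> [|n ihn].
  by apply: eq_integ (integ_cst P 1) => w; rewrite expr0.
pose f M w := truncated_power M n (U w).
have bounded M x : 0 <= M -> `|truncated_power M n x| <= M ^+ n.
  by move=> M0; have /andP[h ?] := truncated_power_itv n x M0; rewrite ger0_norm.
have mt M := measurable_truncated_power M n.
pose u m w := truncated_power m%:R n (U w) * U w ^+ 2.
have iu m : integ P (u m).
  apply: (@integ_mul_bounded _ _ _ _ (m%:R ^+ n)) => //.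
    exact: measurableT_comp.
  by move=> w; apply: bounded.
have it (W : T -> R) m : measurable_fun setT W ->
    integ P (truncated_power m%:R n \o W).
  move=> mW; apply: (@integ_bounded _ _ _ _ (m%:R ^+ n)).
    exact: measurableT_comp.
  by move=> w; apply: bounded.
have ires (W W' : T -> R) m : measurable_fun setT W -> measurable_fun setT W' ->
   integ P (fun w => W w ^+ 2) -> integ P (fun w => W' w ^+ 2) ->
   integ P (fun w => truncated_power m%:R n (W w) * (W' w - r * W w) ^+ 2).
  move=> mW mW' iW iW'; apply: (@integ_mul_bounded _ _ _ _ (m%:R ^+ n)).
  - exact: measurableT_comp.
  - by move=> w; apply: bounded.
  - have := integD (integD iW' (integZ (- (2 * r)) (integM mW' mW iW' iW)))
      (integZ (r ^+ 2) iW).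
    by apply: eq_integ => w; ring.
have u0 m w : 0 <= u m w.
  by apply: mulr_ge0 (sqr_ge0 _); have /andP[] := truncated_power_itv n (U w) (ler0n R m).
have le_u m w : u m w <=
    K * (truncated_power m%:R n (U w) * (V w - r * U w) ^+ 2) +
    K * k ^+ n * (truncated_power m%:R n (V w) * (U w - r * V w) ^+ 2).
  have /andP[tU _] := truncated_power_itv n (U w) (ler0n R m).
  have /andP[tV _] := truncated_power_itv n (V w) (ler0n R m).
  have kn : 0 <= k ^+ n by exact: exprn_ge0.
  rewrite /u; case: (dom (U w) (V w)) => [h|[h h']].
    apply: ler_wpDr.
      exact: mulr_ge0 (mulr_ge0 K0 kn) (mulr_ge0 tV (sqr_ge0 _)).
    by rewrite [leRHS]mulrCA ler_wpM2l.
  apply: ler_wpDl; first exact: mulr_ge0 K0 (mulr_ge0 tU (sqr_ge0 _)).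
  have tUV : truncated_power m%:R n (U w) <= k ^+ n * truncated_power m%:R n (V w).
    rewrite /truncated_power -exprMn lerXn2r ?nnegrE//.
    - by rewrite le_min sqr_ge0/=.
    - by rewrite mulr_ge0// le_min sqr_ge0/=.
    - rewrite minr_pMr// le_min ge_min h' /= ge_min; apply/orP; right.
      by rewrite ler_peMl.
  have := ler_pM tU (sqr_ge0 _) tUV h; move/le_trans; apply.
  by rewrite le_eqVlt; apply/orP; left; apply/eqP; ring.
have mean_u m : mean P (u m) <=
    K * (s * mean P (truncated_power m%:R n \o U)) +
    K * k ^+ n * (s * mean P (truncated_power m%:R n \o U)).
  have j1 := integZ K (ires _ _ m mU mV iU iV).
  have j2 := integZ (K * k ^+ n) (ires _ _ m mV mU iV iU).
  apply: le_trans (le_mean (iu m) (integD j1 j2) (le_u m)) _.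
  have b m' x := bounded m'%:R x (ler0n R m').
  rewrite (meanD j1 j2) (meanZ _ (ires _ _ m mU mV iU iV)).
  rewrite (meanZ _ (ires _ _ m mV mU iV iU)).
  rewrite (residual_U (mt m%:R) (b m)) (residual_V (mt m%:R) (b m)).
  by rewrite -(same_law (mt m%:R) (b m)).
have mt_le m : mean P (truncated_power m%:R n \o U) <= mean P (fun w => U w ^+ n.*2).
  apply: le_mean => // [|w]; first exact: it.
  rewrite /truncated_power /= -mul2n exprM lerXn2r ?nnegrE ?sqr_ge0//.
    by rewrite le_min sqr_ge0/=.
  by rewrite ge_min lexx.
apply: (@integ_fatou _ _ _ P u _
  ((K + K * k ^+ n) * (s * mean P (fun w => U w ^+ n.*2)))).
- exact: iu.
- exact: u0.
- move=> m; apply: le_trans (mean_u m) _; rewrite -mulrDl.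
  have kn : 0 <= k ^+ n by exact: exprn_ge0.
  apply: ler_wpM2l; first by rewrite addr_ge0// mulr_ge0.
  exact: ler_wpM2l s0 _ _ (mt_le m).
- exact: measurable_funX.
- move=> w; apply: cvg_near_cst; near=> m.
  rewrite /u /truncated_power min_l; first by rewrite -exprM -exprD doubleS mul2n addn2.
  apply: ltW; apply: lt_le_trans (truncnS_gt _) _; rewrite ler_nat.
  by near: m; exact: nbhs_infty_ge.
Unshelve. all: by end_near. Qed.
End AllMoments.

(** * q-Hermite polynomials along the process *)

Section QHermite.
Context (R : fieldType).
Implicit Types (q : R) (n : nat).

Definition qnat q n : R := \sum_(i < n) q ^+ i.

(** Rogers' q-Hermite polynomials, normalized to be monic. *)
Fixpoint qhermite q n : {poly R} :=
  match n with
  | 0 => 1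
  | m.+1 => 'X * qhermite q m - qnat q m *: (if m is l.+1 then qhermite q l else 0)
  end.

Lemma qnat0 q : qnat q 0 = 0. Proof. by rewrite /qnat big_ord0. Qed.

Lemma qnatS q n : qnat q n.+1 = 1 + q * qnat q n.
Proof.
rewrite /qnat big_ord_recl expr0 mulr_sumr; congr (_ + _).
by apply: eq_bigr => i _; rewrite exprS.
Qed.

Lemma mulX_qhermite q n :
  'X * qhermite q n = qhermite q n.+1 + qnat q n *: qhermite q n.-1.
Proof. by case: n => [|n] /=; rewrite ?qnat0 ?scale0r subrK. Qed.

Lemma qhermite1 q : qhermite q 1 = 'X.
Proof. by rewrite /= qnat0 scale0r subr0 mulr1. Qed.

Lemma qhermite2 q : qhermite q 2 = 'X * 'X - 1.
Proof.
have := mulX_qhermite q 1; rewrite qhermite1 => ->.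
by rewrite qnatS qnat0 mulr0 addr0 scale1r/= addrK.
Qed.

(** The algebra of the induction step. The last two hypotheses come from the
    linear and the quadratic regression; eliminating [e2] between them leaves a
    multiple of [e1 - r ^+ 3 * x * e0], all other terms cancelling by the
    recurrence of the q-integers [L0], [L1], [L2]. Here [x] stands for [r ^+ j]
    and [y] for [r ^+ j.-1], so that [y * r = x] unless j = 0, when [L0]
    vanishes. *)
Lemma hermite_step_algebra (r a A B C q L0 L1 L2 x y e0 e1 e2 t u : R) :
  r != 0 -> x != 0 -> 1 - A * (1 + r ^+ 2) != 0 -> a * (1 + r ^+ 2) = r ->
  1 + r ^+ 2 != 0 ->
  B * r ^+ 2 = r ^+ 2 - A * r ^+ 4 - A -> C = 1 - 2 * A - B * r ^+ 2 ->
  r ^+ 4 * (1 - A * (1 + r ^+ 2)) * q = r ^+ 2 - A * (1 + r ^+ 2) ->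
  L1 = 1 + q * L0 -> L2 = 1 + q * L1 -> L0 * (y * r) = L0 * x ->
  r ^+ 2 * x * (e1 + L2 * (r * x * t)) =
    a * ((r ^+ 2 * x) ^+ 2 * (e0 + L2 * t) + (e2 + L2 * ((r * x) ^+ 2 * t))) ->
  r * x * (e1 + (L2 + L1) * (r * x * t) + L1 * L0 * (y * u)) =
    A * ((r * x) ^+ 2 * (e0 + (L2 + L1) * t + L1 * L0 * u) +
        (e2 + (L2 + L1) * ((r * x) ^+ 2 * t) + L1 * L0 * (y ^+ 2 * u))) +
    B * ((r ^+ 2 * x) ^+ 2 * (e0 + L2 * t) + L1 * (x ^+ 2 * (t + L0 * u))) +
    C * ((r * x) ^+ 2 * t) ->
  e1 = r ^+ 3 * x * e0.
Proof.
move=> r0 x0 K0 ar r20 Br CE qE L1E L2E L0y H1 H2.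
have e2E : e2 = r * x * (1 + r ^+ 2) * e1 - r ^+ 4 * x ^+ 2 * e0.
  have : (1 + r ^+ 2) * (r ^+ 2 * x * (e1 + L2 * (r * x * t))) = (1 + r ^+ 2) *
    (a * ((r ^+ 2 * x) ^+ 2 * (e0 + L2 * t) + (e2 + L2 * ((r * x) ^+ 2 * t)))).
    by rewrite H1.
  rewrite [RHS]mulrA [_ * a]mulrC ar => h.
  by apply: (mulfI r0); rewrite mulrBr; apply/eqP; rewrite -subr_eq0; apply/eqP;
    move/eqP: h; rewrite -subr_eq0 => /eqP h; rewrite -[RHS]oppr0 -h; ring.
have BE : B = 1 - A * r ^+ 2 - A / r ^+ 2.
  by apply: (mulIf (expf_neq0 2 r0)); rewrite Br; field.
have w : L0 * (r * x * y - A * (r ^+ 2 * x ^+ 2 + y ^+ 2) - B * x ^+ 2) = 0.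
  have -> : L0 * (r * x * y - A * (r ^+ 2 * x ^+ 2 + y ^+ 2) - B * x ^+ 2) =
    x * (L0 * (y * r)) - A * (r ^+ 2 * x ^+ 2 * L0 + (L0 * (y * r)) * y / r) -
    B * x ^+ 2 * L0 by field.
  rewrite L0y; have -> : L0 * x * y / r = (L0 * (y * r)) * x / r ^+ 2 by field.
  by rewrite L0y BE; field.
have c : r ^+ 2 * (1 - 2 * A) * (L2 + L1) = B * (r ^+ 4 * L2 + L1) + C * r ^+ 2.
  have qE' : q = (r ^+ 2 - A * (1 + r ^+ 2)) / (r ^+ 4 * (1 - A * (1 + r ^+ 2))).
    by rewrite -qE [_ * q]mulrC mulfK// mulf_neq0// expf_neq0.
  by rewrite L2E CE BE qE'; field; rewrite r0.
have red : r * x * e1 = A * ((r * x) ^+ 2 * e0 + e2) + B * (r ^+ 4 * x ^+ 2 * e0).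
  have -> : r * x * e1 = r * x * (e1 + (L2 + L1) * (r * x * t) + L1 * L0 * (y * u))
     - x ^+ 2 * t * (r ^+ 2 * (1 - 2 * A) * (L2 + L1))
     - 2 * A * r ^+ 2 * x ^+ 2 * t * (L2 + L1)
     - r * x * (L1 * L0 * (y * u)) by ring.
  rewrite c H2; apply/eqP; rewrite -subr_eq0; apply/eqP.
  transitivity (- (L1 * u) *
    (L0 * (r * x * y - A * (r ^+ 2 * x ^+ 2 + y ^+ 2) - B * x ^+ 2))).
    by ring.
  by rewrite w mulr0.
apply: (mulfI (mulf_neq0 (mulf_neq0 r0 x0) K0)).
transitivity (r * x * e1 - A * (r * x * (1 + r ^+ 2) * e1)); first by ring.
by rewrite [X in X - _]red e2E BE; field.
Qed.

End QHermite.

(** The value of q for which the recurrence coefficients L_{n+1} = 1 + q L_n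
    of the q-Hermite polynomials satisfy the compatibility relation
    (1 - 2 A) r^2 (L_n + L_{n+1}) = B (L_n + r^4 L_{n+1}) + C r^2 imposed by the
    quadratic regression. *)
Definition qparam (R : realType) (r A : R) : R :=
  (r ^+ 2 - A * (1 + r ^+ 2)) / (r ^+ 4 * (1 - A * (1 + r ^+ 2))).

Section PolynomialMartingale.
Context d (T : measurableType d) (R : realType) (P : probability T R).
Variable X : int -> {RV P >-> R}.
Variables a b A B C D : R.
Hypothesis hX : quadratic_regression_field X a b A B C D.
Local Notation r := (autocorr X 1).
Local Notation E := (mean P).
Local Notation past k := [set j : int | j <= k].
Local Notation others k := [set j : int | j != k].
Local Notation q := (qparam r A).
Local Notation H := (qhermite q).

(** The upper bound on [A] is q >= -1 and the lower one is q <= 1. *)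
Lemma qparam_le1 : `|q| <= 1.
Proof.
have K0 := regression_gap hX; have r0 := r_neq0 hX; have r1 := r_sqr_lt1 hX.
have r20 : 0 < r ^+ 2 by rewrite exprn_even_gt0.
have := qrf_A_lower hX; rewrite ler_pdivrMr; last by rewrite exprn_gt0// ltr_wpDr// ltW.
have := qrf_A_upper hX; rewrite ler_pdivlMr; last first.
  by rewrite ltr_wpDr// (exprM _ 2 2) sqr_ge0.
have d0 : 0 < r ^+ 4 * (1 - A * (1 + r ^+ 2)).
  by rewrite mulr_gt0// (exprM _ 2 2) exprn_gt0.
rewrite /qparam ler_norml ler_pdivrMr// ler_pdivlMr// mul1r.
move: d0 r20 r1; rewrite (exprM _ 2 2); move: (r ^+ 2) => x d0 x0 x1 up lo.
apply/andP; split.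
  have := ler_wpM2r (ltW (addr_gt0 ltr01 x0)) up; lra.
have x1' : 0 <= 1 - x by lra.
have := ler_wpM2r x1' lo; lra.
Qed.

Lemma all_moments_X k : all_moments P (X k).
Proof.
have [hXr rE] := reversed_field hX (integ_XX hX).
have s0 : 0 <= 1 - r ^+ 2 by have := r_sqr_lt1 hX; lra.
apply: (@regressions_all_moments _ _ _ P (X k) (X (k + 1)) r (1 - r ^+ 2)).
- exact: measurable_funP.
- exact: measurable_funP.
- exact: (integ_sqr hX k).
- exact: (integ_sqr hX (k + 1)).
- exact: (r_neq0 hX).
- exact: (r_sqr_lt1 hX).
- exact: s0.
- move=> phi c mphi phic.
  have := @stationary_mean1 _ _ _ _ X phi k 1 (qrf_stationary hX) mphi => -> //.
  + apply: (@integ_bounded _ _ _ _ c) => //; exact: measurableT_comp.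
  + apply: (@integ_bounded _ _ _ _ c) => //; exact: measurableT_comp.
- by move=> phi c mphi phic; exact: (residual_past hX k mphi phic).
- move=> phi c mphi phic; have := residual_past hXr (- (k + 1)) mphi phic.
  have -> : reversed X (- (k + 1)) = X (k + 1) by rewrite /reversed opprK.
  have -> : reversed X (- (k + 1) + 1) = X k by rewrite /reversed opprD opprK addrK.
  by rewrite rE.
Qed.

Lemma poly_mean_mulX (Z Y : T -> R) p : 
  poly_mean P (fun w => Z w * Y w) Y p = poly_mean P Z Y ('X * p).
Proof. by apply: eq_mean => w; rewrite hornerM hornerX mulrA. Qed.

Lemma past_sub k l : k <= l -> past k `<=` past l.
Proof. by move=> kl j /= jk; exact: le_trans kl. Qed.

Let am_ZX Z l : all_moments P Z -> all_moments P (fun w => Z w * X l w).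
Proof. by move=> aZ; apply: amM => //; exact: all_moments_X. Qed.

Let am_Zp Z l p : all_moments P Z -> all_moments P (fun w => Z w * p.[X l w]).
Proof. by move=> aZ; apply: amM => //; apply: am_horner; exact: all_moments_X. Qed.

(** The tested form of E(H_n(X_{k+1}) | past) = r^n H_n(X_k). *)
Definition contracts n : Prop := forall k Z,
  adapted X (past k) Z -> all_moments P Z ->
  poly_mean P Z (X (k + 1)) (H n) = r ^+ n * poly_mean P Z (X k) (H n).

Lemma contracts_twice n k Z : contracts n -> adapted X (past k) Z ->
  all_moments P Z ->
  poly_mean P Z (X (k + 2)) (H n) = (r ^+ n) ^+ 2 * poly_mean P Z (X k) (H n).
Proof.
move=> cn mZ aZ; rewrite (_ : k + 2 = k + 1 + 1); last by rewrite -addrA.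
rewrite cn//; first by rewrite cn// expr2 mulrA.
by apply: adapted_sub mZ; apply: past_sub; rewrite lerDl.
Qed.

Lemma contracts0 : contracts 0.
Proof.
move=> k Z mZ aZ; rewrite expr0 mul1r; apply: eq_mean => w.
by rewrite !hornerE.
Qed.

Lemma contracts1 : contracts 1.
Proof.
move=> k Z mZ aZ; rewrite qhermite1 expr1 /poly_mean.
under eq_mean do rewrite hornerX.
under [in RHS]eq_mean do rewrite hornerX.
by apply: (linear_past hX mZ); apply: am_integ; exact: am_ZX.
Qed.

Lemma contracts2 : contracts 2.
Proof.
move=> k Z mZ aZ; rewrite qhermite2.
have iZ2 l : integ P (fun w => Z w * X l w ^+ 2).
  by apply: am_integ; apply: amM => //; apply: amX; exact: all_moments_X.
have split_mean l : poly_mean P Z (X l) ('X * 'X - 1) =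
    E (fun w => Z w * X l w ^+ 2) - E Z.
  rewrite -meanB//; last exact: am_integ.
  apply: eq_mean => w.
  by rewrite -polyC1 !(hornerD, hornerN, hornerM, hornerX, hornerC); ring.
rewrite !split_mean (quadratic_past hX mZ)//; last exact: am_integ.
by ring.
Qed.

(** Two ways of computing E[Z X_{k+1} H_{j+2}(X_{k+2})] and
    E[Z X_{k+1}^2 H_{j+1}(X_{k+2})], expanded by the three-term recurrence. *)
Lemma contracts_step j :
  contracts j.-1 -> contracts j -> contracts j.+1 -> contracts j.+2 ->
  contracts j.+3.
Proof.
move=> cp c0 c1 c2 k Z mZ aZ.
have aX := all_moments_X.
pose L i := qnat q i.
pose x := r ^+ j; pose y := r ^+ j.-1.
have [k0 k2] : k + 1 - 1 = k /\ k + 1 + 1 = k + 2 by rewrite addrK -addrA.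
have mZ1 : adapted X (past (k + 1)) Z.
  by apply: adapted_sub mZ; apply: past_sub; rewrite lerDl.
have mXk l : k <= l -> adapted X (past l) (X k) by move=> kl; apply: adapted_X => /=.
have mZo : adapted X (others (k + 1)) Z by apply: past_others mZ; rewrite ltrDl.
have mpo p : adapted X (others (k + 1)) (fun w => Z w * p.[X (k + 2) w]).
  apply: adaptedM => //; apply: adapted_horner; apply: adapted_X => /=.
  by rewrite (inj_eq (addrI k)).
have aZp := am_Zp _ _ aZ.
have raise l n : poly_mean P Z (X l) ('X * H n) =
    poly_mean P Z (X l) (H n.+1) + L n * poly_mean P Z (X l) (H n.-1).
  by rewrite mulX_qhermite poly_meanD ?poly_meanZ.
have raise' l n : poly_mean P (fun w => Z w * X k w) (X l) ('X * H n) =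
    poly_mean P (fun w => Z w * X k w) (X l) (H n.+1) +
    L n * poly_mean P (fun w => Z w * X k w) (X l) (H n.-1).
  by rewrite mulX_qhermite poly_meanD ?poly_meanZ//; exact: am_ZX.
have raise2 l : poly_mean P Z (X l) ('X * ('X * H j.+1)) =
    poly_mean P Z (X l) (H j.+3) + (L j.+2 + L j.+1) * poly_mean P Z (X l) (H j.+1) +
    L j.+1 * L j * poly_mean P Z (X l) (H j.-1).
  rewrite [in LHS](mulX_qhermite q j.+1) mulrDr -scalerAr poly_meanD// poly_meanZ//.
  by rewrite !raise /= -/(L j.+1); ring.
have swap (Y Y' : T -> R) p : E (fun w => Z w * p.[Y w] * Y' w) =
    poly_mean P (fun w => Z w * Y' w) Y p.
  by apply: eq_mean => w; rewrite mulrAC.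
have swap2 (Y Y' Y'' : T -> R) p : E (fun w => Z w * p.[Y w] * (Y' w * Y'' w)) =
    poly_mean P (fun w => Z w * Y' w * Y'' w) Y p.
  by apply: eq_mean => w; rewrite -!mulrA [p.[_] * _]mulrC !mulrA.
have mZX l : k <= l -> adapted X (past l) (fun w => Z w * X k w).
  by move=> kl; apply: adaptedM (mXk _ kl); apply: adapted_sub mZ; exact: past_sub.
have aZX := am_ZX _ aZ.
have t1 : poly_mean P Z (X (k + 1)) (H j.+1) = r ^+ j.+1 * poly_mean P Z (X k) (H j.+1).
  exact: c1.
have t2 := contracts_twice c1 mZ aZ.
have u1 : poly_mean P Z (X (k + 1)) (H j.-1) = y * poly_mean P Z (X k) (H j.-1).
  exact: cp.
have u2 := contracts_twice cp mZ aZ.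
(* E[Z X_{k+1} H_{j+2}(X_{k+2})], by the linear regression at k + 1 and by the
   contraction of H_{j+2} *)
have lin := linear_test hX (mpo (H j.+2)) (am_integ (am_ZX _ (aZp _ _)))
  (am_integ (am_ZX _ (aZp _ _))) (am_integ (am_ZX _ (aZp _ _))).
rewrite k0 k2 !swap in lin.
have mX1 : adapted X (past (k + 1)) (X (k + 1)) by apply: adapted_X => /=.
have lin1 := c2 _ _ (adaptedM mZ1 mX1) (aZX _).
rewrite k2 poly_mean_mulX raise t1 in lin1.
have lin0 := contracts_twice c2 (mZX _ (lexx k)) (aZX _).
rewrite poly_mean_mulX raise in lin0.
rewrite lin1 lin0 poly_mean_mulX raise t2 in lin.
(* E[Z X_{k+1}^2 H_{j+1}(X_{k+2})], by the quadratic regression at k + 1 and by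
   the contraction of H_{j+1} *)
have i2 l p : integ P (fun w => Z w * p.[X (k + 2) w] * X l w ^+ 2).
  by apply: am_integ; apply: amM => //; exact: amX.
have i11 l l' p : integ P (fun w => Z w * p.[X (k + 2) w] * (X l w * X l' w)).
  by apply: am_integ; apply: amM => //; exact: amM.
have quad := quadratic_test hX (mpo (H j.+1)) (am_integ (aZp _ _))
  (i2 _ _) (i2 _ _) (i2 _ _) (i11 _ _ _).
have sqrE l (p : {poly R}) : E (fun w => Z w * p.[X (k + 2) w] * X l w ^+ 2) =
    poly_mean P (fun w => Z w * X l w * X l w) (X (k + 2)) p.
  by rewrite -swap2; apply: eq_mean => w; rewrite expr2.
rewrite k0 k2 !sqrE swap2 in quad.
have quad1 := c1 _ _ (adaptedM (adaptedM mZ1 mX1) mX1) (am_ZX _ (aZX _)).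
rewrite k2 !poly_mean_mulX raise2 t1 u1 in quad1.
have quad0 := contracts_twice c1 (adaptedM (mZX _ (lexx k)) (mXk _ (lexx k)))
  (am_ZX _ (aZX _)).
rewrite !poly_mean_mulX raise2 in quad0.
have quad2 : poly_mean P (fun w => Z w * X (k + 2) w * X (k + 2) w) (X (k + 2)) (H j.+1) =
    poly_mean P Z (X (k + 2)) (H j.+3) +
    (L j.+2 + L j.+1) * ((r ^+ j.+1) ^+ 2 * poly_mean P Z (X k) (H j.+1)) +
    L j.+1 * L j * (y ^+ 2 * poly_mean P Z (X k) (H j.-1)).
  by rewrite !poly_mean_mulX raise2 t2 u2.
have quad02 : poly_mean P (fun w => Z w * X k w * X (k + 2) w) (X (k + 2)) (H j.+1) =
    (r ^+ j.+2) ^+ 2 *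
      (poly_mean P Z (X k) (H j.+3) + L j.+2 * poly_mean P Z (X k) (H j.+1)) +
    L j.+1 * (x ^+ 2 *
      (poly_mean P Z (X k) (H j.+1) + L j * poly_mean P Z (X k) (H j.-1))).
  rewrite poly_mean_mulX raise' (contracts_twice c2 (mZX _ (lexx k)) (aZX _)).
  rewrite (contracts_twice c0 (mZX _ (lexx k)) (aZX _)) !poly_mean_mulX.
  by rewrite !raise.
have quadc : E (fun w => Z w * (H j.+1).[X (k + 2) w]) =
  (r ^+ j.+1) ^+ 2 * poly_mean P Z (X k) (H j.+1) by exact: t2.
rewrite quad1 quad0 quad2 quad02 quadc in quad.
have r0 := r_neq0 hX.
have K0 := lt0r_neq0 (regression_gap hX).
have r20 : 1 + r ^+ 2 != 0 by rewrite lt0r_neq0// ltr_wpDr// sqr_ge0.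
have rE : [/\ r ^+ j.+1 = r * x, r ^+ j.+2 = r ^+ 2 * x & r ^+ j.+3 = r ^+ 3 * x].
  by split; rewrite -?exprS -?exprD.
have [r1E r2E r3E] := rE.
rewrite r1E r2E in lin quad; rewrite r3E.
apply: (hermite_step_algebra r0 _ K0 (linear_coef hX) r20 (B_relation hX)
  (quadratic_constant hX) _ (qnatS q j) (qnatS q j.+1) _ lin quad).
- by rewrite expf_neq0.
- rewrite /qparam mulrC divfK// mulf_neq0// expf_neq0//.
- rewrite /x /y; case: (j) => [|i]; first by rewrite qnat0 !mul0r.
  by rewrite /= exprSr.
Qed.

Lemma qhermite_contracts n : contracts n.
Proof.
suff all_n m : forall l, (l <= m)%N -> contracts l by exact: (all_n n).
elim: m => [|m ihm] l; first by rewrite leqn0 => /eqP->; exact: contracts0.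
rewrite leq_eqVlt => /predU1P[->{l}|]; last by rewrite ltnS; exact: ihm.
case: m ihm => [|[|j]] ihm; [exact: contracts1|exact: contracts2|].
by apply: contracts_step; apply: ihm; lia.
Qed.

End PolynomialMartingale.

(** * Growth of the moments *)

Section HermiteFunctionals.
Context (R : realType).
Implicit Types (q : R) (f g : {poly R} -> R).

(** The three-term recurrence reduces a product p * qhermite q n to q-Hermite
    polynomials by induction on p. *)
Lemma eq_on_qhermite q f g :
  (forall p1 p2, f (p1 + p2) = f p1 + f p2) -> (forall c p, f (c *: p) = c * f p) ->
  (forall p1 p2, g (p1 + p2) = g p1 + g p2) -> (forall c p, g (c *: p) = c * g p) ->
  (forall n, f (qhermite q n) = g (qhermite q n)) -> f =1 g.
Proof.
move=> fD fZ gD gZ fg p.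
suff mul_qhermite n : f (p * qhermite q n) = g (p * qhermite q n).
  by have := mul_qhermite 0%N; rewrite /= mulr1.
elim/poly_ind: p n => [|p c ihp] n.
  by rewrite mul0r -(scale0r 0) fZ gZ !mul0r.
rewrite mulrDl -mulrA mulX_qhermite mul_polyC mulrDr -scalerAr.
by rewrite !(fD, gD, fZ, gZ) fg !ihp.
Qed.

Lemma norm_qnat_le q n : `|q| <= 1 -> `|qnat q n| <= n%:R.
Proof.
move=> q1; apply: le_trans (ler_norm_sum _ _ _) _.
rewrite -[n in leRHS]card_ord -sum1_card natr_sum; apply: ler_sum => i _.
by rewrite normrX exprn_ile1.
Qed.

(** By the three-term recurrence these values solve
    M(n+1, j) = M(n, j+1) + L_j M(n, j-1) with |L_j| <= j, and they vanish for
    j > n; so 2 (j + 1) + 2 j <= 6 (n + 1) is all that the induction takes. *)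
Lemma hermite_moment_bound q f : `|q| <= 1 ->
  (forall p1 p2, f (p1 + p2) = f p1 + f p2) -> (forall c p, f (c *: p) = c * f p) ->
  (forall n, f (qhermite q n) = (n == 0%N)%:R) ->
  forall n j, f ('X^n * qhermite q j) ^+ 2 <= (j <= n)%:R * (6 ^+ n * n`!%:R * j`!%:R).
Proof.
move=> q1 fD fZ f0; elim=> [|n ihn] j.
  rewrite expr0 mul1r f0 leqn0; case: eqP => [->|_] /=.
    by rewrite !fact0 expr0 !mulr1 expr1n.
  by rewrite expr0n /= mul0r.
have -> : f ('X^(n.+1) * qhermite q j) =
    f ('X^n * qhermite q j.+1) + qnat q j * f ('X^n * qhermite q j.-1).
  by rewrite exprSr -mulrA mulX_qhermite mulrDr -scalerAr fD fZ.
have h1 := ihn j.+1; have h2 := ihn j.-1; have h3 := norm_qnat_le j q1.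
move: h1 h2; set u := f _; set v := f _ => h1 h2.
have c0 : 0 <= 6 ^+ n * n`!%:R :> R by rewrite mulr_ge0 ?exprn_ge0.
have {}h3 : (qnat q j) ^+ 2 <= j%:R ^+ 2.
  by rewrite -real_normK ?num_real// lerXn2r ?nnegrE.
have sq2 : (u + qnat q j * v) ^+ 2 <= 2 * (u ^+ 2 + j%:R ^+ 2 * v ^+ 2).
  have : qnat q j ^+ 2 * v ^+ 2 <= j%:R ^+ 2 * v ^+ 2 by rewrite ler_wpM2r ?sqr_ge0.
  by have := sqr_ge0 (u - qnat q j * v); lra.
apply: le_trans sq2 _.
have [jn|nj] := leqP j n.+1; last first.
  rewrite mul0r; move: h1 h2.
  have -> : (j.+1 <= n)%N = false by lia.
  have -> : (j.-1 <= n)%N = false by lia.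
  rewrite !mul0r => h1 h2.
  have -> : u ^+ 2 = 0 by apply: le_anti; rewrite h1 sqr_ge0.
  have -> : v ^+ 2 = 0 by apply: le_anti; rewrite h2 sqr_ge0.
  by rewrite mulr0 addr0 mulr0.
have le1 (b : bool) (x : R) : 0 <= x -> b%:R * x <= x.
  by move=> x0; case: b; rewrite ?mul1r ?mul0r.
have {}h1 : u ^+ 2 <= 6 ^+ n * n`!%:R * (j.+1%:R * j`!%:R).
  by apply: le_trans h1 _; rewrite -natrM -factS; apply: le1; rewrite mulr_ge0.
have {}h2 : j%:R ^+ 2 * v ^+ 2 <= 6 ^+ n * n`!%:R * (j%:R * j`!%:R).
  case: (j) h2 => [|i] h2; first by rewrite expr0n/= !mul0r mulr0.
  have -> : 6 ^+ n * n`!%:R * (i.+1%:R * (i.+1)`!%:R) =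
     i.+1%:R ^+ 2 * (6 ^+ n * n`!%:R * i`!%:R) :> R by rewrite factS natrM; ring.
  rewrite ler_wpM2l ?sqr_ge0//; apply: le_trans h2 _ => /=; apply: le1.
  by rewrite mulr_ge0.
rewrite mul1r (exprS 6 n) factS natrM.
have jn' : j.+1%:R + j%:R <= 3 * n.+1%:R :> R by rewrite -natrD -natrM ler_nat; lia.
have := ler_wpM2l (mulr_ge0 c0 (ler0n R j`!)) jn'.
move: h1 h2; move: (6 ^+ n) (n`!%:R) (j`!%:R) (j.+1%:R) (n.+1%:R) => s x y z t.
move: (j%:R ^+ 2 * v ^+ 2) => v'; move: (u ^+ 2) (j%:R) => u' j' h1 h2 h.
have -> : 6 * s * (t * x) * y = 2 * (s * x * y * (3 * t)) by ring.
by apply: le_trans (ler_wpM2l _ h) => //; lra.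
Qed.

Lemma fact_double_le n : ((n.*2)`! <= 4 ^ n * (n`! * n`!))%N.
Proof.
elim: n => // n ihn; rewrite doubleS !factS expnS.
apply: (@leq_trans (n.*2.+2 * (n.*2.+1 * (4 ^ n * (n`! * n`!))))).
  by rewrite !leq_mul2l ihn !orbT.
by rewrite -mul2n; nia.
Qed.

Lemma even_moment_bound q f : `|q| <= 1 ->
  (forall p1 p2, f (p1 + p2) = f p1 + f p2) -> (forall c p, f (c *: p) = c * f p) ->
  (forall n, f (qhermite q n) = (n == 0%N)%:R) ->
  forall n, f 'X^(n.*2) <= 12 ^+ n * n`!%:R.
Proof.
move=> q1 fD fZ f0 n; have := hermite_moment_bound q1 fD fZ f0 n.*2 0.
rewrite /= mulr1 mul1r fact0 mulr1 => h.
have [neg|pos] := leP (f 'X^(n.*2)) 0.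
  by apply: le_trans neg _; rewrite mulr_ge0 ?exprn_ge0.
rewrite -(ler_pXn2r (n := 2)) ?nnegrE ?(ltW pos) ?mulr_ge0 ?exprn_ge0//.
apply: le_trans h _; rewrite -mul2n exprM.
have -> : (12 ^+ n * n`!%:R) ^+ 2 = (6 ^+ 2) ^+ n * (4 ^ n * (n`! * n`!))%:R :> R.
  rewrite natrM natrX natrM; have -> : (12 : R) = 6 * 2 by ring.
  have -> : (4 : R) = 2 ^+ 2 by ring.
  by rewrite !exprMn; ring.
by rewrite ler_wpM2l ?exprn_ge0// ler_nat mul2n fact_double_le.
Qed.

End HermiteFunctionals.

Section GaussianTails.
Context d (T : measurableType d) (R : realType) (P : probability T R).

(** The terms of the series of exp (X^2 / 24) have means at most 2^(-n), and
    by t |x| <= x^2 / 24 + 6 t^2 that function dominates every exponential up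
    to a constant factor. *)
Lemma exp_moments_of_even (X : T -> R) : all_moments P X ->
  (forall n, mean P (fun w => X w ^+ n.*2) <= 12 ^+ n * n`!%:R) ->
  exp_moments P X.
Proof.
move=> aX X12; have mX := am_meas aX.
have iexp : integ P (fun w => expR (X w ^+ 2 / 24)).
  have ipow (i : nat) : integ P (fun w => (X w ^+ 2 / 24) ^+ i / i`!%:R).
    apply: am_integ; under eq_fun do rewrite mulrC.
    apply: amZ; apply: amX; under eq_fun do rewrite mulrC.
    by apply: amZ; exact: amX.
  apply: (@integ_fatou _ _ _ P
    (fun n w => \sum_(0 <= i < n) ((X w ^+ 2 / 24) ^+ i / i`!%:R)) _ 2).
  - move=> n; exact: (integ_sum (index_iota 0 n) ipow).
  - move=> n w; apply: sumr_ge0 => i _.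
    by apply: exp_coeff_ge0; rewrite divr_ge0 ?sqr_ge0.
  - move=> n; rewrite (mean_sum (index_iota 0 n) ipow).
    apply: (@le_trans _ _ (\sum_(0 <= i < n) (1 / 2) ^+ i)).
      apply: ler_sum => i _.
      have -> : mean P (fun w => (X w ^+ 2 / 24) ^+ i / i`!%:R) =
          24^-1 ^+ i / i`!%:R * mean P (fun w => X w ^+ i.*2).
        rewrite -meanZ; last by apply: am_integ; exact: amX.
        by apply: eq_mean => w; rewrite exprMn -mul2n exprM; ring.
      apply: le_trans (ler_wpM2l _ (X12 i)) _.
        by rewrite divr_ge0// exprn_ge0.
      have -> : 1 / 2 = 24^-1 * 12 :> R by field.
      rewrite exprMn le_eqVlt; apply/orP; left; apply/eqP; field.
      by rewrite pnatr_eq0 -lt0n fact_gt0.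
    have -> : \sum_(0 <= i < n) (1 / 2) ^+ i = 2 - 2 * (1 / 2) ^+ n :> R.
      elim: n => [|n ihn]; first by rewrite big_geq// expr0; ring.
      by rewrite big_nat_recr//= ihn exprS; field.
    by rewrite lerBlDr lerDl mulr_ge0 ?exprn_ge0.
  - apply: measurableT_comp => //; apply: measurable_funM => //.
    exact: measurable_funX.
  - by move=> w; exact: is_cvg_series_exp_coeff.
split=> // s; have mexp t : measurable_fun setT (fun w => expR (t * `|X w|)).
  apply: measurableT_comp => //; apply: measurable_funM => //.
  exact: measurableT_comp.
apply: am_even => // n; pose t := n.*2%:R * s.
apply: (@integ_le _ _ _ _ _ (fun w => expR (6 * t ^+ 2) * expR (X w ^+ 2 / 24))).
- exact: measurable_funX.
- exact: integZ.
- move=> w; rewrite -expRM_natl mulrA -/t ger0_norm ?expR_ge0// -expRD ler_expR.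
  rewrite -(real_normK (num_real (X w))).
  have := sqr_ge0 (`|X w| - 12 * t); lra.
Qed.

End GaussianTails.

Section Moments.
Context d (T : measurableType d) (R : realType) (P : probability T R).
Variable X : int -> {RV P >-> R}.
Variables a b A B C D : R.
Hypothesis hX : quadratic_regression_field X a b A B C D.
Local Notation r := (autocorr X 1).
Local Notation H := (qhermite (qparam r A)).

Lemma one_poly_meanE (Y : T -> R) p : poly_mean P (fun=> 1) Y p = mean P (fun w => p.[Y w]).
Proof. by apply: eq_mean => w; rewrite mul1r. Qed.

(** By stationarity E H_n(X_k) = r^n E H_n(X_k), and r^n != 1 for n > 0. *)
Lemma mean_qhermite k n : poly_mean P (fun=> 1) (X k) (H n) = (n == 0%N)%:R.
Proof.
case: n => [|n].
  rewrite one_poly_meanE -[RHS](mean_cst P 1).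
  by apply: eq_mean => w; rewrite /= -polyC1 hornerC.
have := qhermite_contracts hX n.+1 (@adapted_cst _ _ _ _ X [set j | j <= k] 1)
  (am_cst P 1).
rewrite !one_poly_meanE.
have mH : measurable_fun setT (horner (H n.+1)).
  by apply: continuous_measurable_fun => x; exact: continuous_horner.
have iH l : integ P (fun w => (H n.+1).[X l w]).
  by apply: am_integ; apply: am_horner; exact: (all_moments_X hX).
rewrite (@stationary_mean1 _ _ _ _ X _ k 1 (qrf_stationary hX) mH)// => h.
apply/eqP; move/eqP: h; rewrite -subr_eq0 -{1}[mean P _]mul1r -mulrBl mulf_eq0.
case/orP => //; rewrite subr_eq0 => /eqP r1; exfalso.
have : (r ^+ 2) ^+ n.+1 < 1 by rewrite exprn_ilt1 ?sqr_ge0 ?(r_sqr_lt1 hX).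
by rewrite -exprM mulnC exprM -r1 expr1n ltxx.
Qed.

Lemma exp_moments_X k : exp_moments P (X k).
Proof.
have aX := all_moments_X hX k; have a1 := am_cst P (1 : R).
apply: exp_moments_of_even => // n.
have := even_moment_bound (qparam_le1 hX) (poly_meanD a1 aX) (poly_meanZ a1 aX)
  (mean_qhermite k) n.
by rewrite one_poly_meanE; under eq_mean do rewrite hornerXn.
Qed.

End Moments.

(** * Mixed moments and finite-dimensional laws *)

Section JointLaw.
Context (R : realType).
Context d (T : measurableType d) (P : probability T R).
Variable X : int -> {RV P >-> R}.
Context d' (T' : measurableType d') (P' : probability T' R).
Variable X' : int -> {RV P' >-> R}.
Variables a b A B C D a' b' B' C' D' : R.
Hypothesis hX : quadratic_regression_field X a b A B C D.
Hypothesis hX' : quadratic_regression_field X' a' b' A B' C' D'.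
Hypothesis rE : autocorr X' 1 = autocorr X 1.

Let aX := all_moments_X hX.
Let aX' := all_moments_X hX'.

(** Products over an integer interval, in increasing order of time: the form in
    which the last variable can be conditioned on the previous ones. *)
Definition window_prod d0 (T0 : measurableType d0) (P0 : probability T0 R)
  (Y : int -> {RV P0 >-> R}) (p : nat -> {poly R}) (s : int) (n : nat) (w : T0) : R :=
  \prod_(i < n) (p i).[Y (s + Posz i) w].

Lemma am_window_prod d0 (T0 : measurableType d0) (P0 : probability T0 R)
  (Y : int -> {RV P0 >-> R}) p s n : (forall k, all_moments P0 (Y k)) ->
  all_moments P0 (window_prod Y p s n).
Proof. by move=> aY; apply: am_prod => i; exact: am_horner. Qed.

Lemma adapted_window_prod d0 (T0 : measurableType d0) (P0 : probability T0 R)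
  (Y : int -> {RV P0 >-> R}) p s n :
  adapted Y [set j | j <= s + Posz n] (window_prod Y p s n.+1).
Proof.
have lastE m : window_prod Y p s m.+1 =
    fun w => window_prod Y p s m w * (p m).[Y (s + Posz m) w].
  by apply/funext => w; rewrite /window_prod big_ord_recr.
elim: n => [|n ihn]; rewrite lastE.
  have -> : window_prod Y p s 0 = fun=> 1.
    by apply/funext => w; rewrite /window_prod big_ord0.
  by apply: adaptedM; [exact: adapted_cst|apply: adapted_horner; apply: adapted_X => /=].
apply: adaptedM; last by apply: adapted_horner; apply: adapted_X => /=.
by apply: adapted_sub ihn; apply: past_sub; rewrite lerD2l lez_nat.
Qed.

(** Conditioning on the past replaces H_m of the last variable by r^m H_m of the
    one before, whose factor absorbs it; so the induction on the length of the
    window brings every mixed moment down to r and q. *)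
Lemma mixed_moments p s n (l : {poly R}) :
  poly_mean P (window_prod X p s n) (X (s + Posz n)) l =
  poly_mean P' (window_prod X' p s n) (X' (s + Posz n)) l.
Proof.
have qE : qparam (autocorr X' 1) A = qparam (autocorr X 1) A by rewrite rE.
elim: n l => [|n ihn] l.
  have E0 d0 (T0 : measurableType d0) (P0 : probability T0 R)
      (Y : int -> {RV P0 >-> R}) : window_prod Y p s 0 = fun=> 1.
    by apply/funext => w; rewrite /window_prod big_ord0.
  rewrite !E0; apply: (@eq_on_qhermite _ (qparam (autocorr X 1) A)
    (poly_mean P (fun=> 1) (X (s + 0))) (poly_mean P' (fun=> 1) (X' (s + 0)))).
  - exact: poly_meanD (am_cst _ _) (aX _).
  - exact: poly_meanZ (am_cst _ _) (aX _).
  - exact: poly_meanD (am_cst _ _) (aX' _).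
  - exact: poly_meanZ (am_cst _ _) (aX' _).
  - by move=> n; rewrite (mean_qhermite hX) -qE (mean_qhermite hX').
have am1 := am_window_prod p s n.+1 aX; have am1' := am_window_prod p s n.+1 aX'.
apply: (@eq_on_qhermite _ (qparam (autocorr X 1) A)
  (poly_mean P (window_prod X p s n.+1) (X (s + Posz n.+1)))
  (poly_mean P' (window_prod X' p s n.+1) (X' (s + Posz n.+1)))).
- exact: poly_meanD am1 (aX _).
- exact: poly_meanZ am1 (aX _).
- exact: poly_meanD am1' (aX' _).
- exact: poly_meanZ am1' (aX' _).
move=> m; have -> : s + Posz n.+1 = s + Posz n + 1 by rewrite -addrA -PoszD addn1.
have c := qhermite_contracts hX m (@adapted_window_prod _ _ _ X p s n) am1.
have c' := qhermite_contracts hX' m (@adapted_window_prod _ _ _ X' p s n) am1'.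
rewrite qE rE in c'; rewrite c c'; congr (_ * _).
have last_factor d0 (T0 : measurableType d0) (P0 : probability T0 R)
    (Y : int -> {RV P0 >-> R}) u : poly_mean P0 (window_prod Y p s n.+1) (Y (s + Posz n)) u =
    poly_mean P0 (window_prod Y p s n) (Y (s + Posz n)) (p n * u).
  by apply: eq_mean => w; rewrite /window_prod big_ord_recr hornerM mulrA.
by rewrite !last_factor.
Qed.

(** Factors with the same index are collected into one polynomial, which is 1
    for the indices of the window that do not occur. *)
Lemma prod_by_index d0 (T0 : measurableType d0) (P0 : probability T0 R)
    (Y : int -> {RV P0 >-> R}) (ps : seq (int * {poly R})) (N : nat) w :
  (forall x, x \in ps -> (`|x.1| <= N)%N) ->
  \prod_(x <- ps) x.2.[Y x.1 w] =
  window_prod Y (fun i => \prod_(x <- ps | x.1 == - Posz N + Posz i) x.2)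
    (- Posz N) (N + N).+1 w.
Proof.
move=> psN; rewrite /window_prod.
under [RHS]eq_bigr do rewrite horner_prod.
rewrite (exchange_big_dep predT)//= big_seq [RHS]big_seq.
apply: eq_bigr => x /psN xN.
case: x xN => z u /= zN.
have hlt : (absz (z + Posz N)%R < (N + N).+1)%N by lia.
have zE : z = - Posz N + Posz (absz (z + Posz N)%R) by lia.
rewrite (big_pred1 (Ordinal hlt)) /=; first by rewrite -zE.
move=> i /=; apply/eqP/eqP => [iE|->//].
by apply/val_inj => /=; lia.
Qed.

Lemma mean_prod_poly (ps : seq (int * {poly R})) :
  mean P (fun w => \prod_(x <- ps) x.2.[X x.1 w]) =
  mean P' (fun w => \prod_(x <- ps) x.2.[X' x.1 w]).
Proof.
have [N psN] : exists N, forall x, x \in ps -> (`|x.1| <= N)%N.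
  elim: ps => [|x ps [N ihN]]; first by exists 0%N.
  exists (maxn `|x.1| N) => y; rewrite inE leq_max => /predU1P[->|/ihN ->].
    by rewrite leqnn.
  by rewrite orbT.
under eq_mean do rewrite (prod_by_index X _ psN).
under [RHS]eq_mean do rewrite (prod_by_index X' _ psN).
have := mixed_moments (fun i => \prod_(x <- ps | x.1 == - Posz N + Posz i) x.2)
  (- Posz N) (N + N).+1 1.
by rewrite /poly_mean; under eq_mean do rewrite -polyC1 hornerC mulr1;
  under [in RHS]eq_mean do rewrite -polyC1 hornerC mulr1.
Qed.

(** Each step of the induction replaces a polynomial factor by an indicator: the
    product of all the other factors, indicators included, is a weight to which
    one-dimensional determinacy applies. *)
Lemma mean_prod_indic (bs : seq (int * set R)) (ps : seq (int * {poly R})) :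
  (forall i : nat, measurable (nth (0, set0) bs i).2) ->
  mean P (fun w => \prod_(x <- bs) \1_(x.2) (X x.1 w) *
                   \prod_(x <- ps) x.2.[X x.1 w]) =
  mean P' (fun w => \prod_(x <- bs) \1_(x.2) (X' x.1 w) *
                    \prod_(x <- ps) x.2.[X' x.1 w]).
Proof.
elim: bs ps => [|[i S] bs ihbs] ps mbs.
  under eq_mean do rewrite big_nil mul1r.
  under [RHS]eq_mean do rewrite big_nil mul1r.
  exact: mean_prod_poly.
have mS : measurable S by exact: (mbs 0%N).
have {}mbs j : measurable (nth (0, set0) bs j).2 by exact: (mbs j.+1).
pose W0 d0 (T0 : measurableType d0) (P0 : probability T0 R)
    (Y : int -> {RV P0 >-> R}) w :=
  \prod_(x <- bs) \1_(x.2) (Y x.1 w) * \prod_(x <- ps) x.2.[Y x.1 w].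
have aW0 d0 (T0 : measurableType d0) (P0 : probability T0 R)
    (Y : int -> {RV P0 >-> R}) : (forall k, all_moments P0 (Y k)) ->
    all_moments P0 (W0 _ _ _ Y).
  move=> aY; apply: amM; last by apply: am_prod => x; exact: am_horner.
  elim: (bs) mbs => [|x bs' ih] mbs'.
    by under eq_fun do rewrite big_nil; exact: am_cst.
  under eq_fun do rewrite big_cons.
  apply: amM; last by apply: ih => j; exact: (mbs' j.+1).
  apply: (@am_bounded _ _ _ _ 1) => [|w].
    apply: measurableT_comp; last exact: measurable_funP.
    by apply: measurable_indic; exact: (mbs' 0%N).
  exact: norm_indic_le1.
have WW' : matched P (X i) P' (X' i) (W0 _ _ _ X) (W0 _ _ _ X').
  split=> [||p]; [exact: aW0|exact: aW0|].
  have := ihbs ((i, p) :: ps) mbs.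
  have E1 d0 (T0 : measurableType d0) (P0 : probability T0 R)
    (Y : int -> {RV P0 >-> R}) :
    mean P0 (fun w => \prod_(x <- bs) \1_(x.2) (Y x.1 w) *
       \prod_(x <- (i, p) :: ps) x.2.[Y x.1 w]) = poly_mean P0 (W0 _ _ _ Y) (Y i) p.
    by apply: eq_mean => w; rewrite big_cons /W0/=; ring.
  by rewrite !E1.
have [_ _ keep] := preserving_indic (exp_moments_X hX i) (exp_moments_X hX' i) mS.
have [_ _ /(_ 1)] := keep _ _ WW'.
have E2 d0 (T0 : measurableType d0) (P0 : probability T0 R)
    (Y : int -> {RV P0 >-> R}) :
    poly_mean P0 (fun w => W0 _ _ _ Y w * \1_S (Y i w)) (Y i) 1 =
    mean P0 (fun w => \prod_(x <- (i, S) :: bs) \1_(x.2) (Y x.1 w) *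
       \prod_(x <- ps) x.2.[Y x.1 w]).
  by apply: eq_mean => w; rewrite big_cons -polyC1 hornerC mulr1 /W0/=; ring.
by rewrite !E2.
Qed.

Lemma same_fdd_box n (k : 'I_n -> int) (S : 'I_n -> set R) :
  (forall i, measurable (S i)) ->
  fdd X k [set t | forall i, S i (tnth t i)] =
  fdd X' k [set t | forall i, S i (tnth t i)].
Proof.
move=> mS; pose bs := [seq (k i, S i) | i <- enum 'I_n].
have mbs j : measurable (nth (0, set0) bs j).2.
  have [jn|nj] := ltnP j (size bs); last first.
    by rewrite nth_default //; exact: measurable0.
  by have /mapP[i _ ->] := mem_nth (0, set0) jn; exact: mS.
have := mean_prod_indic [::] mbs.
have fddE d0 (T0 : measurableType d0) (P0 : probability T0 R)
    (Y : int -> {RV P0 >-> R}) :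
    (mean P0 (fun w => \prod_(x <- bs) \1_(x.2) (Y x.1 w) *
       \prod_(x <- [::]) x.2.[Y x.1 w]))%:E =
    fdd Y k [set t | forall i, S i (tnth t i)].
  rewrite /fdd; set Z := [set w | _].
  have ZE w : Z w <-> forall i, S i (Y (k i) w).
    by rewrite /Z/=; split=> h i; have := h i; rewrite tnth_mktuple.
  have mZ : measurable Z.
    have -> : Z = \bigcap_(i in [set: 'I_n]) (Y (k i) @^-1` S i).
      by apply/seteqP; split=> w; [move=> /ZE h i _; exact: h|move=> h; apply/ZE => i; exact: h].
    apply: fin_bigcap_measurable => // i _.
    by rewrite -[_ @^-1` _]setTI; exact: measurable_funP.
  rewrite -mean_indic//; congr EFin; apply: eq_mean => w.
  rewrite big_nil mulr1 big_map big_enum /=; rewrite [RHS]indicE.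
  have [hw|hw] := boolP (w \in Z).
    rewrite big1// => i _; rewrite indicE mem_set//.
    by move: hw; rewrite inE => /ZE; exact.
  have /existsNP[i hi] : ~ (forall i, S i (Y (k i) w)).
    by move=> h; move/negP: hw; apply; rewrite inE; apply/ZE.
  by rewrite (bigD1 i)//= indicE memNset// mul0r.
by move=> h; rewrite -!fddE h.
Qed.

Lemma measurable_tuple_boxes n : @measurable _ (n.-tuple R) =
  <<s [set B | exists2 S : 'I_n -> set R, (forall i, measurable (S i)) &
        B = [set t | forall i, S i (tnth t i)]] >>.
Proof.
apply/seteqP; split.
  apply: smallest_sub; first exact: smallest_sigma_algebra.
  move=> S0; rewrite -bigcup_seq => -[i _ [S mS <-]]; rewrite setTI.
  apply: sub_gen_smallest; exists (fun j => if j == i then S else setT).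
    by move=> j; case: ifP.
  apply/seteqP; split=> t /= h; last by have := h i; rewrite eqxx.
  by move=> j; case: eqP => // ->.
apply: smallest_sub; first exact: sigma_algebra_measurable.
move=> _ [S mS ->].
have -> : [set t : n.-tuple R | forall i, S i (tnth t i)] =
    \bigcap_(i in [set: 'I_n]) ((fun t => tnth t i) @^-1` S i).
  by apply/seteqP; split=> t h i //=; apply: h.
apply: fin_bigcap_measurable => // i _.
by rewrite -[_ @^-1` _]setTI; apply: measurable_tnth.
Qed.

Lemma field_same_fdd : same_fdd X X'.
Proof.
move=> n k S0; rewrite measurable_tuple_boxes; move: S0.
apply: (@dynkin_induction _ _ _ (fun S => fdd X k S = fdd X' k S)
  (measurable_tuple_boxes n)).
- move=> _ _ [S mS ->] [S' mS' ->]; exists (fun i => S i `&` S' i).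
    by move=> i; exact: measurableI.
  apply/seteqP; split=> t /=; first by move=> [h h'] i.
  by move=> h; split=> i; have [] := h i.
- have E d0 (T0 : measurableType d0) (P0 : probability T0 R)
    (Y : int -> {RV P0 >-> R}) : fdd Y k setT = 1%E by exact: probability_setT.
  by rewrite !E.
- by move=> _ [S mS ->]; exact: same_fdd_box.
- have mfdd d0 (T0 : measurableType d0) (P0 : probability T0 R)
    (Y : int -> {RV P0 >-> R}) S : measurable S ->
    fdd Y k (~` S) = (1 - fdd Y k S)%E.
    move=> mS; rewrite -probability_setC//.
    have := measurable_coordinates Y k measurableT mS.
    by rewrite setTI.
  by move=> S mS h; rewrite !mfdd// h.
- move=> F mF tF h.
  have fddU d0 (T0 : measurableType d0) (P0 : probability T0 R)
    (Y : int -> {RV P0 >-> R}) : fdd Y k (\bigcup_j F j) =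
      (\sum_(j <oo) fdd Y k (F j))%E.
    have mk := measurable_coordinates Y k.
    have mFk j : measurable ((fun w => [tuple Y (k i) w | i < n]) @^-1` F j).
      by rewrite -[_ @^-1` _]setTI; apply: mk.
    have tFk : trivIset setT (fun j => (fun w => [tuple Y (k i) w | i < n]) @^-1` F j).
      move=> i j _ _ [w [wi wj]].
      by apply: (tF i j) => //; exists [tuple Y (k i) w | i < n].
    have mU := bigcupT_measurable _ mFk.
    have <- := measure_semi_bigcup P0 mFk tFk mU.
    by rewrite -preimage_bigcup.
  by rewrite !fddU; apply: eq_eseriesr => j _.
Qed.

End JointLaw.

(** * The Markov property *)

Section RestrictedLaw.
Context d (T : measurableType d) (R : realType) (P : probability T R).
Variables (G : set T) (mG : measurable G) (Y : {RV P >-> R}).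

(** The measurability of [G] is an argument so that the measure structure below
    can be inferred from the term. *)
Definition restricted_law of measurable G := fun S : set R => P (G `&` Y @^-1` S).

Local Notation law := (restricted_law mG).

Let mY (S : set R) : measurable S -> measurable (Y @^-1` S).
Proof. by move=> mS; rewrite -[_ @^-1` _]setTI; exact: measurable_funP. Qed.

Let law0 : law set0 = 0%E.
Proof. by rewrite /restricted_law preimage_set0 setI0 measure0. Qed.

Let law_ge0 S : (0 <= law S)%E.
Proof. exact: measure_ge0. Qed.

Let law_sigma_additive : semi_sigma_additive law.
Proof.
move=> F mF tF mU; rewrite /restricted_law preimage_bigcup setI_bigcupr.
apply: measure_semi_sigma_additive.
- by move=> i; apply: measurableI => //; exact: mY.
- by move=> i j _ _ [w [[_ wi] [_ wj]]]; apply: (tF i j) => //; exists (Y w).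
- by apply: bigcupT_measurable => i; apply: measurableI => //; exact: mY.
Qed.

HB.instance Definition _ := isMeasure.Build _ _ _ law
  law0 law_ge0 law_sigma_additive.

Let law_fin : fin_num_fun law.
Proof. by move=> S mS; apply: fin_num_measure; apply: measurableI => //; exact: mY. Qed.

HB.instance Definition _ := Measure_isFinite.Build _ _ _ law law_fin.

Lemma restricted_law_le S : measurable S -> (law S <= distribution P Y S)%E.
Proof.
move=> mS; apply: le_measure; rewrite ?inE; last exact: subIsetr.
  by apply: measurableI => //; exact: mY.
exact: mY.
Qed.

(** A Radon-Nikodym density, clamped to [0, 1] to make it a bounded weight. On
    the set where the density exceeds 1 the restricted law is at most the
    integral of 1, that is, of the clamped density; so clamping loses no
    mass. *)
Lemma restricted_law_density : exists g : R -> R,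
  [/\ measurable_fun setT g, forall x, `|g x| <= 1 &
   forall S, measurable S -> mean P (fun w => \1_S (Y w) * \1_G w) =
     mean P (fun w => \1_S (Y w) * g (Y w))].
Proof.
have dom : law `<< distribution P Y.
  apply/null_content_dominatesP => S mS S0; apply/eqP.
  by rewrite eq_le measure_ge0 andbT -S0 restricted_law_le.
have [f [f0 intf lawf]] := radon_nikodym_finite dom.
pose mu : probability R R := distribution P Y.
have lawE S : measurable S -> law S = (\int[mu]_(x in S) f x)%E by exact: lawf.
have mf : measurable_fun setT f by exact: measurable_int intf.
pose h x := Order.min (f x) 1%E.
have h0 x : (0 <= h x)%E by rewrite le_min f0 lee_fin ler01.
have hfin x : h x \is a fin_num.
  by rewrite ge0_fin_numE// gt_min [X in _ || X]ltry orbT.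
have mh : measurable_fun setT h by exact: measurable_mine.
have lawh S : measurable S -> law S = (\int[mu]_(x in S) h x)%E.
  move=> mS; apply/eqP; rewrite eq_le; apply/andP; split; last first.
    rewrite lawE//; apply: ge0_le_integral => //.
    - exact: measurable_funTS.
    - exact: measurable_funTS.
    - by move=> x _; rewrite /h ge_min lexx.
  pose S1 := [set x | (1 < f x)%E].
  have mS1 : measurable S1.
    by rewrite -[S1]setTI; apply: emeasurable_fun_o_infty.
  have SE : S = (S `\` S1) `|` (S `&` S1) by rewrite setDE -setIUr setvU setIT.
  have m1 : measurable (S `\` S1) by exact: measurableD.
  have m2 : measurable (S `&` S1) by exact: measurableI.
  rewrite [in leRHS]SE ge0_integral_setU//=; last 2 first.
  - exact: measurable_funTS.
  - by apply/disj_setPS => x [[_ nx] [_ x1]]; exact: nx.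
  have -> : law S = (law (S `\` S1) + law (S `&` S1))%E by exact: measureDI.
  apply: leeD.
    rewrite lawE//; apply: ge0_le_integral => //.
    - exact: measurable_funTS.
    - exact: measurable_funTS.
    - by move=> x [_ /negP]; rewrite -leNgt => x1; rewrite /h min_l.
  apply: le_trans (restricted_law_le m2) _.
  rewrite -[leLHS]mul1e -(integral_cst mu m2 1); apply: ge0_le_integral => //.
  - exact: measurable_funTS.
  - by move=> x [_ /= x1]; rewrite /h min_r// ltW.
exists (fine \o h); split.
- exact: measurableT_comp.
- move=> x /=; rewrite ger0_norm ?fine_ge0// -lee_fin fineK//.
  by rewrite ge_min lexx orbT.
move=> S mS.
have mYw : measurable_fun setT Y by exact: measurable_funP.
have mg : measurable_fun setT (fun x => \1_S x * fine (h x)).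
  by apply: measurable_funM; [exact: measurable_indic|exact: measurableT_comp].
have g01 x : 0 <= \1_S x * fine (h x) <= 1.
  have hx1 : fine (h x) <= 1 by rewrite -lee_fin fineK// ge_min lexx orbT.
  have hx0 : 0 <= fine (h x) by exact: fine_ge0.
  by rewrite indicE; case: (_ \in _); rewrite ?mul1r ?mul0r ?hx0 ?hx1 ?lexx ?ler01.
have ig : integ P (fun w => \1_S (Y w) * fine (h (Y w))).
  apply: (@integ_bounded _ _ _ _ 1) => [|w].
    exact: (measurableT_comp mg mYw).
  by have /andP[g0 g1] := g01 (Y w); rewrite ger0_norm.
apply: EFin_inj; rewrite (mean_EFin ig).
have -> : (fun w => \1_S (Y w) * \1_G w) = \1_(G `&` Y @^-1` S) :> (T -> R).
  by apply/funext => w; rewrite !indicE in_setI mulrC -natrM mulnb.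
rewrite mean_indic; last by apply: measurableI => //; exact: mY.
rewrite -[LHS]/(law S) lawh// integral_mkcond.
transitivity (\int[mu]_x (\1_S x * fine (h x))%:E)%E.
  apply: eq_integral => x _; rewrite patchE indicE.
  by case: ifP; rewrite ?mul1r ?mul0r// fineK.
rewrite /mu ge0_integral_distribution//; first exact/measurable_EFinP.
by move=> x; rewrite lee_fin; have /andP[] := g01 x.
Qed.

End RestrictedLaw.

Section Markov.
Context d (T : measurableType d) (R : realType) (P : probability T R).
Variable X : int -> {RV P >-> R}.

Lemma sigma_of_set1 k A : sigma_of X [set k] A ->
  exists2 S, measurable S & A = X k @^-1` S.
Proof.
rewrite /sigma_of bigcup_set1; move: A; apply: smallest_sub.
  split.
  - by exists set0; rewrite ?preimage_set0.
  - move=> _ [S mS ->]; exists (~` S); first exact: measurableC.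
    by rewrite setTD preimage_setC.
  - move=> F hF; have /choice[S hS] : forall j, exists S, measurable S /\ F j = X k @^-1` S.
      by move=> j; have [S mS FS] := hF j; exists S.
    exists (\bigcup_j S j); first by apply: bigcupT_measurable => j; have [] := hS j.
    by rewrite preimage_bigcup; apply: eq_bigcupr => j _; have [] := hS j.
by move=> _ [S mS <-]; exists S; rewrite ?setTI.
Qed.

(** The conditional probability of an event given one variable exists as a
    bounded Borel function of that variable. *)
Lemma conditional_density k (G : set T) : measurable G -> exists g : R -> R,
  [/\ measurable_fun setT g, forall x, `|g x| <= 1 &
   forall Z, adapted X [set k] Z -> integ P Z ->
     mean P (fun w => Z w * \1_G w) = mean P (fun w => Z w * g (X k w))].
Proof.
move=> mG; have [g [mg g1 dens]] := restricted_law_density mG (X k).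
exists g; split=> // Z mZ iZ.
have mgX : measurable_fun setT (g \o X k) by exact: measurableT_comp.
have iZG : integ P (fun w => Z w * \1_G w).
  by under eq_fun do rewrite mulrC; exact: integ_indicM.
have iZg : integ P (fun w => Z w * g (X k w)).
  by under eq_fun do rewrite mulrC; apply: (@integ_mul_bounded _ _ _ _ 1).
apply/eqP; rewrite -subr_eq0 -meanB//; under eq_mean do rewrite -mulrBr.
apply/eqP; apply: (adapted_orthogonal (X := X) (J := [set k])) => //.
- by apply: integB; [exact: integ_indic|exact: (@integ_bounded _ _ _ _ 1)].
- move=> A kA; have mA := sigma_of_measurable kA.
  have [S mS AE] := sigma_of_set1 kA.
  under eq_mean do rewrite mulrBr.
  rewrite meanB; last 2 first.
  + by apply: integ_indicM => //; exact: integ_indic.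
  + by apply: integ_indicM => //; exact: (@integ_bounded _ _ _ _ 1).
  apply/eqP; rewrite subr_eq0; apply/eqP.
  have indE w : \1_A w = \1_S (X k w) :> R by rewrite AE.
  under eq_mean do rewrite indE.
  under [RHS]eq_mean do rewrite indE.
  exact: dens.
- by under eq_fun do rewrite mulrBr; exact: integB.
Qed.

Lemma cond_exp_versionP J (V Y : T -> R) : integ P V -> integ P Y -> adapted X J Y ->
  (forall A, sigma_of X J A ->
    mean P (fun w => \1_A w * Y w) = mean P (fun w => \1_A w * V w)) ->
  cond_exp_version P (sigma_of X J) V Y.
Proof.
move=> iV iY mY test; split=> //.
- exact/Lfun1_integrable.
- exact/Lfun1_integrable.
move=> A JA; have mA := sigma_of_measurable JA.
have restrictE f : integ P f ->
    (mean P (fun w => \1_A w * f w))%:E = (\int[P]_(w in A) (f w)%:E)%E.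
  move=> jf; rewrite mean_restrict// fineK//; apply: integrable_fin_num => //.
  exact: integrableS jf.
by rewrite -!restrictE// test.
Qed.

Variables a b A B C D : R.
Hypothesis hX : quadratic_regression_field X a b A B C D.

(** For a past event G with conditional probability g(X_k), the weights 1_G and
    g(X_k) have the same means against q-Hermite polynomials of the next
    variable, hence against indicators of it. *)
Lemma field_markov : markov_chain X.
Proof.
move=> k S mS.
have aX := all_moments_X hX.
have mN : measurable (X (k + 1) @^-1` S).
  by rewrite -[_ @^-1` _]setTI; exact: measurable_funP.
have [f [mf f1 fdens]] := conditional_density k mN.
have adapted_f J : J k -> adapted X J (fun w => f (X k w)).
  by move=> Jk; apply: adapted_comp => //; exact: adapted_X.
have mfX : measurable_fun setT (f \o X k) by exact: measurableT_comp.
have ifX : integ P (fun w => f (X k w)) by exact: (@integ_bounded _ _ _ _ 1).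
have iN := integ_indic P mN.
exists (fun w => f (X k w)).
  apply: cond_exp_versionP => //; first exact: adapted_f.
  move=> A' kA; rewrite fdens//; first exact: adapted_indic.
  by apply: integ_indic; exact: sigma_of_measurable kA.
exists (fun w => f (X k w)); last by apply: aeW.
apply: cond_exp_versionP => //; first by apply: adapted_f => /=.
move=> G pG; have mG := sigma_of_measurable pG.
have [g [mg g1 gdens]] := conditional_density k mG.
have mgX : measurable_fun setT (g \o X k) by exact: measurableT_comp.
have aG := am_indic P mG.
have ag : all_moments P (fun w => g (X k w)) by exact: (@am_bounded _ _ _ _ 1).
have past_of_present Z : adapted X [set k] Z -> adapted X [set j | j <= k] Z.
  by apply: adapted_sub => j ->/=.
have adapted_g : adapted X [set k] (fun w => g (X k w)).
  by apply: adapted_comp => //; exact: adapted_X.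
have GG' : matched P (X (k + 1)) P (X (k + 1)) \1_G (fun w => g (X k w)).
  split=> // p; move: p.
  apply: (@eq_on_qhermite _ (qparam (autocorr X 1) A)
    (poly_mean P \1_G (X (k + 1))) (poly_mean P (fun w => g (X k w)) (X (k + 1)))).
  - exact: poly_meanD aG (aX _).
  - exact: poly_meanZ aG (aX _).
  - exact: poly_meanD ag (aX _).
  - exact: poly_meanZ ag (aX _).
  move=> n; rewrite (qhermite_contracts hX n (adapted_indic pG) aG).
  rewrite (qhermite_contracts hX n (past_of_present _ adapted_g) ag); congr (_ * _).
  rewrite /poly_mean; under eq_mean do rewrite mulrC.
  under [RHS]eq_mean do rewrite mulrC.
  apply: gdens; first by apply: adapted_horner; exact: adapted_X.
  by apply: am_integ; exact: am_horner.
have [_ _ keep] := preserving_indic (exp_moments_X hX (k + 1))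
  (exp_moments_X hX (k + 1)) mS.
have [_ _ /(_ 1)] := keep _ _ GG'.
have E1 (W : T -> R) : poly_mean P (fun w => W w * \1_S (X (k + 1) w)) (X (k + 1)) 1 =
    mean P (fun w => W w * \1_(X (k + 1) @^-1` S) w).
  by apply: eq_mean => w; rewrite -polyC1 hornerC mulr1.
rewrite !E1 => ->; rewrite (fdens _ adapted_g (am_integ ag)).
under [RHS]eq_mean do rewrite mulrC.
rewrite -gdens//; first by apply: eq_mean => w; rewrite mulrC.
exact: adapted_f.
Qed.

End Markov.

Local Close Scope ring_scope.
Local Close Scope classical_set_scope.

Theorem theorem2p3 (R : realType)
    (d : measure_display) (T : measurableType d) (P : probability T R)
    (X : int -> {RV P >-> R}) (a b A B C D : R)
    (hX : quadratic_regression_field X a b A B C D) :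
  markov_chain X /\
  (forall (d' : measure_display) (T' : measurableType d')
     (P' : probability T' R) (X' : int -> {RV P' >-> R})
     (a' b' B' C' D' : R),
     quadratic_regression_field X' a' b' A B' C' D' ->
     autocorr X' 1 = autocorr X 1 ->
     same_fdd X X').
Proof.
split; first exact: (field_markov hX).
move=> d' T' P' X' a' b' B' C' D' hX' rE.
exact: (field_same_fdd hX hX' rE).
Qed.
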